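(* Let $G$ be a simple undirected graph (not necessarily finite). Then $G$ is (isomorphic to) the basis graph of a matroid if and only if $G$ is connected, satisfies the interval condition and the positioning condition, and has at least one vertex with finitely many neighbors.
   Context: A matroid on a finite set $I$ is a non-empty collection $\mathcal{B}$ of subsets of $I$, called bases, such that for all $A,B\in\mathcal{B}$ and $a\in A\setminus B$ there exists $b\in B\setminus A$ with $(A\setminus\{a\})\cup\{b\}\in\mathcal{B}$. The basis graph of $\mathcal{B}$ is the graph whose vertices are the bases, two bases $A,B$ being adjacent if and only if $|A\Delta B|=2$. For a graph $G$, $d(u,v)$ is the shortest-path distance, and the interval between $u$ and $v$ is $I(u,v)=\{x: d(u,x)+d(x,v)=d(u,v)\}$ (it contains $u$ and $v$). A square is an induced 4-cycle. A pyramid is the wheel $W_4$ (a 4-cycle plus a vertex adjacent to all four of its vertices). An octahedron is $K_6$ minus a perfect matching. Interval condition: for any $u,v$ with $d(u,v)=2$, the subgraph induced by $I(u,v)$ is a square, a pyramid, or an octahedron. Positioning condition: for every vertex $v$ and every square $u_1u_2u_3u_4$ of $G$ (vertices in cyclic order), $d(v,u_1)+d(v,u_3)=d(v,u_2)+d(v,u_4)$. *)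

(* Defs.v *)
From mathcomp Require Import all_boot.
From mathcomp Require Import all_classical.

Set Implicit Arguments.
Unset Strict Implicit.
Unset Printing Implicit Defensive.

Local Open Scope classical_set_scope.

Record sgraph := SGraph {
  vertex :> Type;
  adj : vertex -> vertex -> Prop;
  adj_sym : forall u v, adj u v -> adj v u;
  adj_irr : forall v, ~ adj v v }.

Definition isomorphic (G H : sgraph) : Prop :=
  exists2 f : G -> H, bijective f & forall u v, adj u v <-> adj (f u) (f v).

Section Induced.
Variables (G : sgraph) (A : set G).

Definition induced_adj (u v : set_type A) : Prop := adj (val u) (val v).

Fact induced_sym u v : induced_adj u v -> induced_adj v u.
Proof. exact: adj_sym. Qed.

Fact induced_irr v : ~ induced_adj v v.
Proof. exact: adj_irr. Qed.

Definition induced : sgraph := SGraph induced_sym induced_irr.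

End Induced.

Section Metric.
Variable G : sgraph.

Fixpoint walk (n : nat) (u v : G) : Prop :=
  if n is m.+1 then exists2 w, adj u w & walk m w v else u = v.

Definition graph_connected : Prop := forall u v : G, exists n, walk n u v.

(** Vertices in different components get the junk value 0; [dist] is only
    meaningful together with [graph_connected]. *)
Definition dist (u v : G) : nat :=
  xget 0 [set n | walk n u v /\ forall m, walk m u v -> n <= m].

Definition interval (u v : G) : set G :=
  [set x | dist u x + dist x v = dist u v].

Definition neighbors (v : G) : set G := [set w | adj v w].

(** The last two lines make the two diagonals distinct non-adjacent pairs, so
    that the 4-cycle is induced and has four different vertices. *)
Definition is_square (u1 u2 u3 u4 : G) : Prop :=
  [/\ adj u1 u2, adj u2 u3, adj u3 u4 & adj u4 u1] /\
  (u1 <> u3 /\ ~ adj u1 u3) /\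
  (u2 <> u4 /\ ~ adj u2 u4).

End Metric.

Definition cycle4_adj (i j : 'I_4) : Prop :=
  j = i.+1 %[mod 4] \/ i = j.+1 %[mod 4].

Fact cycle4_sym i j : cycle4_adj i j -> cycle4_adj j i.
Proof. by case; [right | left]. Qed.

Fact cycle4_irr i : ~ cycle4_adj i i.
Proof. by case: i => [[|[|[|[|i]]]] ?] // []. Qed.

Definition square_graph : sgraph := SGraph cycle4_sym cycle4_irr.

(** The hub of the wheel is [None]. *)
Definition wheel4_adj (x y : option 'I_4) : Prop :=
  match x, y with
  | Some i, Some j => cycle4_adj i j
  | None, None => False
  | _, _ => True
  end.

Fact wheel4_sym x y : wheel4_adj x y -> wheel4_adj y x.
Proof. by case: x y => [i|] [j|] //; exact: cycle4_sym. Qed.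

Fact wheel4_irr x : ~ wheel4_adj x x.
Proof. by case: x => [i|] //; exact: cycle4_irr. Qed.

Definition pyramid_graph : sgraph := SGraph wheel4_sym wheel4_irr.

(** The removed perfect matching consists of the pairs
    [(i, false)], [(i, true)]. *)
Definition octahedron_adj (x y : 'I_3 * bool) : Prop := x.1 <> y.1.

Fact octahedron_sym x y : octahedron_adj x y -> octahedron_adj y x.
Proof. by move=> xy yx; apply: xy. Qed.

Fact octahedron_irr x : ~ octahedron_adj x x.
Proof. by apply. Qed.

Definition octahedron_graph : sgraph := SGraph octahedron_sym octahedron_irr.

Definition interval_condition (G : sgraph) : Prop :=
  forall u v : G, dist u v = 2 ->
    [\/ isomorphic (induced (interval u v)) square_graph,
        isomorphic (induced (interval u v)) pyramid_graph
      | isomorphic (induced (interval u v)) octahedron_graph].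

Definition positioning_condition (G : sgraph) : Prop :=
  forall v u1 u2 u3 u4 : G, is_square u1 u2 u3 u4 ->
    dist v u1 + dist v u3 = dist v u2 + dist v u4.

Record matroid (I : finType) := Matroid {
  bases : {set {set I}};
  bases_nonempty : exists A, A \in bases;
  bases_exchange : forall A B, A \in bases -> B \in bases ->
    forall a, a \in A :\: B ->
    exists2 b, b \in B :\: A & (A :\ a) :|: [set b]%SET \in bases }.

Section BasisGraph.
Variables (I : finType) (M : matroid I).

Definition basis_adj (A B : {A : {set I} | A \in bases M}) : Prop :=
  #|(val A :\: val B) :|: (val B :\: val A)| = 2.

Fact basis_sym A B : basis_adj A B -> basis_adj B A.
Proof. by rewrite /basis_adj finset.setUC. Qed.

Fact basis_irr A : ~ basis_adj A A.
Proof. by rewrite /basis_adj finset.setDv finset.setU0 cards0. Qed.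

Definition basis_graph : sgraph := SGraph basis_sym basis_irr.

End BasisGraph.

(* Main.v *)
Require Import Defs.
From mathcomp Require Import all_boot.
From mathcomp Require Import all_classical.
From mathcomp Require Import zify.

Set Implicit Arguments.
Unset Strict Implicit.
Unset Printing Implicit Defensive.

Local Open Scope nat_scope.

(** For bases [A] and [B] of a matroid the graph distance is [#|A :\: B|]: the
    exchange property yields a path of that length, and a step changes the
    difference by at most one element. A square of the basis graph has equal
    meets and equal joins on its two diagonals, so it is balanced as a multiset
    equation, and the positioning condition is the count of that equation
    ([embedded_positioning]). The interval between bases at distance two is a
    subset without empty row or column of the two-by-two grid of exchanges, which
    is the interval condition ([embedded_diagonal]).

    Conversely, let [b] be a vertex with finitely many neighbours. The idea is to
    recover the exchanges leading from [b] to its neighbours, to read off from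
    distances which exchanges a vertex [A] has in common with them, and to check
    that the resulting map into sets is isometric.

    - Two neighbours of [b] should be adjacent exactly when they remove the same
      element or add the same element, that is, the link of [b] should be the line
      graph of a bipartite graph. It contains no diamond ([no_diamond]) and no
      claw ([no_claw]), hence every neighbour lies in at most two maximal cliques,
      the vertices of the root graph (the ends below). The root graph has no odd
      closed walk ([no_odd_walk]): a shortest one yields an induced odd hole of
      the link, and the positioning condition turns it into an induced hole in the
      link of one of its vertices, with two vertices fewer, until a pentagon
      contradicts the interval condition. A two-colouring of the root graph
      separates removed from added elements ([link_labels]).

    - For a vertex [A], the neighbours of [b] closer to [A] determine sets
      [removed A] and [added A]. By the triangle condition and the interval
      condition they determine all distances from neighbours of [b] to [A]
      ([nb_dist_labels]), and both have [dist b A] elements ([card_labels]). So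
      [lam A], which is [b] without the removed and with the added elements, has
      constant size.

    - The positioning condition, applied at [b] and its neighbours, shows that
      [lam] maps a square with edges of length one to a balanced square
      ([square_lam_balanced]). Counting in balanced squares shows that [lam]
      preserves distance one ([adj_lamD]), hence distance two, hence all distances
      ([lam_dist]): given [A] at distance at least three, the distance to the
      first corner of a square on a geodesic follows from those to the other
      three.

    - An isometric family of sets in which vertices at distance two span a square
      has the exchange property ([embedded_exchange]). *)

(** * Walks, distances and two-colourings *)

Section Walks.
Variable G : sgraph.
Implicit Types u v w : G.

Lemma walk_cat m n u v w : walk m u v -> walk n v w -> walk (m + n) u w.
Proof.
elim: m u => [|m IHm] u /=; first by move=> ->.
by move=> [z uz zv] vw; exists z => //; exact: IHm.
Qed.

Lemma walk_sym n u v : walk n u v -> walk n v u.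
Proof.
elim: n u v => [|n IHn] u v; first by move=> ->.
move=> [w uw wv].
rewrite -addn1; apply: walk_cat (IHn _ _ wv) _.
by exists u; first exact: adj_sym.
Qed.

Lemma walk_seq n (h : nat -> G) i j : i <= j -> j <= n ->
  (forall l, l < n -> adj (h l) (h l.+1)) -> walk (j - i) (h i) (h j).
Proof.
move=> ij jn hh; rewrite -{2}(subnKC ij).
have : i + (j - i) <= n by lia.
elim: (j - i) => [|l IHl] il; first by rewrite addn0.
rewrite -[l.+1]addn1; apply: (walk_cat (IHl _)); first by lia.
by exists (h (i + (l + 1))); rewrite //= addnA addn1; apply: hh; lia.
Qed.

Lemma walk_vertices n u v : walk n u v ->
  exists h : nat -> G, [/\ h 0 = u, h n = v
    & forall l, l < n -> adj (h l) (h l.+1)].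
Proof.
elim: n u => [|n IHn] u /=; first by move=> ->; exists (fun=> v).
move=> [w uw /IHn [h [h0 hn hh]]].
exists (fun i => if i is j.+1 then h j else u); split=> // -[|l] ln /=.
  by rewrite h0.
exact: hh.
Qed.

(** Splitting the walks from a base point of each component by the parity of
    their lengths gives the colouring. *)
Lemma two_colouring (c : G) :
  (forall m u, ~ walk m.*2.+1 u u) ->
  exists col : G -> bool, forall u v, adj u v -> col u = ~~ col v.
Proof.
move=> noodd.
pose comp u := [set v | exists n, walk n u v]%classic.
have [base baseP] : exists base : set G -> G,
    forall S, (exists v, S v) -> S (base S).
  have ch (S : set G) : exists v, (exists v, S v) -> S v.
    have [[v Sv]|nS] := pselect (exists v, S v); first by exists v.
    by exists c.
  by have [base baseP] := boolp.choice ch; exists base.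
have to_base u : exists n, walk n u (base (comp u)).
  by apply: (baseP (comp u)); exists u, 0.
exists (fun u => `[< exists n, walk n.*2 u (base (comp u)) >]) => u v uv.
have vu := adj_sym uv.
have -> : comp u = comp v.
  apply/funext => w; apply/propext; split=> -[n nw]; exists n.+1.
    by exists u.
  by exists v.
case: (to_base v) => n; case: (asboolP (exists n, walk n.*2 v _)) => [[p vp]|nv] vn.
  apply/asboolP => -[q uq]; apply: (noodd (q + p) u).
  rewrite doubleD -addnS; apply: (walk_cat uq).
  by rewrite -addn1; apply: walk_cat (walk_sym vp) _; exists u.
have on : odd n.
  by apply: contrapT => /negP on; apply: nv; exists n./2; rewrite even_halfK.
apply/asboolP; exists n.+1./2; rewrite even_halfK /= ?on //.
by exists v.
Qed.

End Walks.

Section Distance.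
Variable G : sgraph.
Hypothesis conn : graph_connected G.
Implicit Types u v w x : G.

Lemma distP u v : walk (dist u v) u v /\ forall m, walk m u v -> dist u v <= m.
Proof.
rewrite /dist; apply: (@xgetPex _ _
  [set n | walk n u v /\ forall m, walk m u v -> n <= m]%classic).
have ex : exists n, `[< walk n u v >].
  by have [n] := conn u v; exists n; apply/asboolP.
case: (ex_minnP ex) => n /asboolP nw min; exists n; split=> // m mw.
by apply: min; apply/asboolP.
Qed.

Lemma dist_walk u v : walk (dist u v) u v. Proof. by case: (distP u v). Qed.

Lemma dist_min m u v : walk m u v -> dist u v <= m.
Proof. by case: (distP u v) => _; apply. Qed.

Lemma distC u v : dist u v = dist v u.
Proof.
by apply/eqP; rewrite eqn_leq !dist_min //; apply: walk_sym; exact: dist_walk.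
Qed.

Lemma dist_triangle v u w : dist u w <= dist u v + dist v w.
Proof. by apply: dist_min; apply: walk_cat; exact: dist_walk. Qed.

Lemma distvv u : dist u u = 0.
Proof. by apply/eqP; rewrite -leqn0; exact: (@dist_min 0). Qed.

Lemma dist0 u v : dist u v = 0 -> u = v.
Proof. by move=> d0; have := dist_walk u v; rewrite d0. Qed.

Lemma dist1 u v : dist u v = 1 <-> adj u v.
Proof.
split=> [d1|uv]; first by have := dist_walk u v; rewrite d1 => -[w uw <-].
have : dist u v <= 1 by apply: dist_min; exists v.
case d0: (dist u v) => [|[|//]] // _.
by move: uv; rewrite (dist0 d0) => /adj_irr.
Qed.

Lemma dist_adj x u v : adj u v -> dist x u <= dist x v + 1.
Proof.
move=> uv; have := dist_triangle v x u.
by rewrite (_ : dist v u = 1) //; apply/dist1; exact: adj_sym.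
Qed.

Lemma closer x u n : dist x u = n.+1 -> exists2 w, adj w u & dist x w = n.
Proof.
rewrite distC => d; have := dist_walk u x; rewrite d => -[w uw wx].
exists w; first exact: adj_sym.
by have := dist_min (walk_sym wx); have := dist_adj x uw; rewrite (distC x u); lia.
Qed.

Lemma dist2 w u v : adj u w -> adj w v -> u <> v -> ~ adj u v -> dist u v = 2.
Proof.
move=> uw wv nuv nadj.
have := dist_adj u (adj_sym wv); rewrite (iffRL (dist1 u w) uw).
case d: (dist u v) => [|[|[|//]]] // _; first by case: nuv; exact: dist0.
by case: nadj; apply/dist1.
Qed.

Lemma dist2P u v : dist u v = 2 -> u <> v /\ ~ adj u v.
Proof.
by move=> d; split=> [uv|/dist1]; [move: d; rewrite uv distvv | rewrite d].
Qed.

End Distance.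

Lemma isomorphic_sym (G H : sgraph) : isomorphic G H -> isomorphic H G.
Proof.
move=> [f [g fK gK] fadj]; exists g; first by exists f.
by move=> u v; rewrite fadj !gK.
Qed.

(** * The interval condition in terms of common neighbours *)

Definition common (G : sgraph) (u v w : G) := adj u w /\ adj w v.

(** Among any three common neighbours exactly one pair is non-adjacent. The second
    clause speaks of one of the two remaining pairs only; the other follows by
    exchanging [p] and [q]. *)
Definition one_gap (G : sgraph) (u v : G) :=
  forall p q r, common u v p -> common u v q -> common u v r ->
  p <> q -> q <> r -> p <> r ->
  ~ (adj p q /\ adj q r /\ adj p r) /\ (~ adj p q -> adj p r).

(** Together with a square, [one_gap] leaves just the three intervals of the
    interval condition: it bounds the number of common neighbours by four and
    makes those outside the square adjacent to both of its free corners. *)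
Definition diagonal_condition (G : sgraph) (u v : G) :=
  (exists p q, is_square u p v q) /\ one_gap u v.

(** The 4-cycle is the complete bipartite graph of parities. *)
Lemma square_adjE (i j : square_graph) : adj i j <-> odd (i + j).
Proof.
by rewrite /= /cycle4_adj; have := ltn_ord i; have := ltn_ord j; lia.
Qed.

Lemma square_diagonal (u v : square_graph) : u <> v -> ~ adj u v ->
  diagonal_condition u v.
Proof.
rewrite square_adjE => nuv nadj.
have nuv' : (u : nat) <> v by move=> /val_inj.
have uv_odd : odd u = odd v by lia.
split; last first.
  move=> p q r; rewrite /common !square_adjE => -[up _] [uq _] [ur _] npq nqr npr.
  have npq' : (p : nat) <> q by move=> /val_inj.
  have nqr' : (q : nat) <> r by move=> /val_inj.
  have npr' : (p : nat) <> r by move=> /val_inj.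
  by have := ltn_ord p; have := ltn_ord q; have := ltn_ord r; lia.
pose p : 'I_4 := inord (~~ odd u); pose q : 'I_4 := inord (2 + ~~ odd u).
have pE : p = ~~ odd u :> nat by rewrite inordK //; lia.
have qE : q = 2 + ~~ odd u :> nat by rewrite inordK //; lia.
exists p, q; split; first by split; apply/square_adjE; lia.
split; split; rewrite ?square_adjE; try lia; first by [].
by move=> /(congr1 val) /=; lia.
Qed.

Lemma pyramid_diagonal (u v : pyramid_graph) : u <> v -> ~ adj u v ->
  diagonal_condition u v.
Proof.
case: u v => [u|] [v|] nuv nadj; [|by case: nadj..|by case: nuv].
have {}nuv : u <> v by move=> uv; apply: nuv; rewrite uv.
have [[p [q [[up pv vq qu] [uv pq]]]] gf] := @square_diagonal u v nuv nadj.
split.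
  exists (Some p), (Some q); split; first by split.
  split; first by split=> // -[].
  by split=> [[]|]; [case: pq | case: pq].
pose meets (r : square_graph) := @common square_graph u v r.
have two (r s t : square_graph) : meets r -> meets s -> meets t ->
    r <> s -> s <> t -> r <> t -> False.
  rewrite /meets /common !square_adjE => -[ur _] [us _] [ut _] nrs nst nrt.
  have nrs' : (r : nat) <> s by move=> /val_inj.
  have nst' : (s : nat) <> t by move=> /val_inj.
  have nrt' : (r : nat) <> t by move=> /val_inj.
  have := ltn_ord r; have := ltn_ord s.
  by have := ltn_ord t; have := ltn_ord u; lia.
have nonadj (r s : square_graph) : meets r -> meets s -> ~ adj r s.
  by rewrite /meets /common !square_adjE; lia.
move=> [p'|] [q'|] [r'|] cp cq cr npq nqr npr //=.
- by case: (@two p' q' r') => //; [move=> e; apply: npq; rewrite e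
    | move=> e; apply: nqr; rewrite e | move=> e; apply: npr; rewrite e].
- by split=> // -[pq' _]; exact: (@nonadj p' q').
- by split=> [[_ [_ pr]]|[]//]; exact: (@nonadj p' r').
- by split=> [[_ [qr _]]|[]//]; exact: (@nonadj q' r').
Qed.

Lemma octahedron_diagonal (u v : octahedron_graph) : u <> v -> ~ adj u v ->
  diagonal_condition u v.
Proof.
case: u v => [i e] [j f] nuv /= /contrapT /= ij; rewrite -{}ij in nuv *.
have {}nuv : e <> f by move=> ef; apply: nuv; rewrite ef.
have [k ki] : exists k : 'I_3, k <> i.
  exists (if i == ord0 then inord 1 else ord0).
  by case: eqP => [-> /(congr1 val)|/nesym //]; rewrite /= inordK.
split.
  exists (k, true), (k, false); split; first by split=> //=; exact: nesym.
  split; first by split=> [[]|[]].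
  by split=> // -[].
move=> [p bp] [q bq] [r br] [/= ip _] [/= iq _] [/= ir _] npq nqr npr.
rewrite /adj /= /octahedron_adj /=; split.
  move=> [pq [qr pr]].
  have no (x y : 'I_3) : x <> y -> (x : nat) <> y by move=> xy /val_inj.
  move: (no _ _ ip) (no _ _ iq) (no _ _ ir) (no _ _ pq) (no _ _ qr) (no _ _ pr) => /=.
  by have := ltn_ord i; have := ltn_ord p; have := ltn_ord q; have := ltn_ord r; lia.
move=> /contrapT pq pr; subst q r.
by move: npq nqr npr; clear; case: bp bq br => [] [] [].
Qed.

Section IntervalCondition.
Variable G : sgraph.
Hypothesis conn : graph_connected G.

Lemma interval2 (u v w : G) : dist u v = 2 ->
  interval u v w <-> [\/ w = u, w = v | common u v w].
Proof.
move=> d2; rewrite /interval /= d2; split.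
  case dw: (dist u w) => [|[|[|n]]]; last by lia.
  - by move=> _; constructor 1; rewrite (dist0 conn dw).
  - move=> [wv]; constructor 3; split; first by apply/(dist1 conn).
    by apply/(dist1 conn).
  - move=> wv; constructor 2; apply: (dist0 conn); lia.
case=> [->|->|[uw wv]]; rewrite ?(distvv conn) ?d2 //.
by rewrite (iffRL (dist1 conn _ _) uw) (iffRL (dist1 conn _ _) wv).
Qed.

Lemma iso_diagonal (u v : G) (H : sgraph) : dist u v = 2 ->
  isomorphic (induced (interval u v)) H ->
  (forall p q : H, p <> q -> ~ adj p q -> diagonal_condition p q) ->
  diagonal_condition u v.
Proof.
move=> d2 [f [g fK gK] fadj] Hdiag.
have mem w := interval2 w d2.
have mem_u : u \in interval u v by apply/mem_set/mem; constructor 1.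
have mem_v : v \in interval u v by apply/mem_set/mem; constructor 2.
have mem_c w : common u v w -> w \in interval u v.
  by move=> cw; apply/mem_set/mem; constructor 3.
pose F w (wI : w \in interval u v) : H := f (exist _ w wI).
have Fadj w wI w' wI' : adj (@F w wI) (@F w' wI') <-> adj w w'.
  by rewrite /F -fadj.
have Feq w wI w' wI' : @F w wI = @F w' wI' -> w = w'.
  by move=> /(can_inj fK) [].
have [nuv nadj] := dist2P conn d2.
have [||[p [q [[up pv vq qu] [_ [npq npq']]]]] gf] :=
    Hdiag (F _ mem_u) (F _ mem_v).
- by move=> /Feq.
- by rewrite Fadj.
have gE r : r = F _ (svalP (g r)).
  by rewrite /F -[LHS]gK; congr f; apply: val_inj.
split.
  have gadj r w wI : adj r (@F w wI) <-> adj (sval (g r)) w.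
    by rewrite {1}(gE r) Fadj.
  exists (sval (g p)), (sval (g q)); split.
    by split; [apply/adj_sym/gadj/adj_sym|apply/gadj|apply/adj_sym/gadj/adj_sym
      |apply/gadj].
  split=> //; split.
    by move=> pq; apply: npq; rewrite (gE p) (gE q) /F; congr f; apply: val_inj.
  by rewrite -(Fadj _ (svalP (g p)) _ (svalP (g q))) -!gE.
move=> r s t cr cs ct nrs nst nrt.
have [] := gf (F _ (mem_c _ cr)) (F _ (mem_c _ cs)) (F _ (mem_c _ ct)).
all: rewrite /common ?Fadj //.
all: by move=> /Feq.
Qed.

Lemma interval_diagonal : interval_condition G ->
  forall u v : G, dist u v = 2 -> diagonal_condition u v.
Proof.
move=> IC u v d2.
case: (IC u v d2) => /(iso_diagonal d2); apply.
- exact: square_diagonal.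
- exact: pyramid_diagonal.
- exact: octahedron_diagonal.
Qed.

Lemma induced_iso (A : set G) (H : sgraph) (g : H -> G) :
  (forall w, A w <-> exists h, g h = w) -> injective g ->
  (forall h h', adj h h' <-> adj (g h) (g h')) ->
  isomorphic (induced A) H.
Proof.
move=> Ag ginj gadj; apply: isomorphic_sym.
have gA h : g h \in A by apply/mem_set/Ag; exists h.
pose f h : induced A := exist _ (g h) (gA h).
have ex (w : induced A) : exists h, f h = w.
  case: w => w wA; have /Ag [h hw] := set_mem wA.
  by exists h; apply: val_inj.
have [f' f'K] := boolp.choice ex.
exists f; last by move=> h h'; exact: gadj.
exists f' => // h; have := f'K (f h); move=> /(congr1 val) /=; exact: ginj.
Qed.

(** The square accounts for four vertices of the interval. A further common
    neighbour is the hub of a pyramid; two of them are non-adjacent and complete an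
    octahedron; three of them would be pairwise non-adjacent. *)
Lemma diagonal_interval :
  (forall u v : G, dist u v = 2 -> diagonal_condition u v) ->
  interval_condition G.
Proof.
move=> diag u v d2; have [sqr gf] := diag u v d2.
have [p [q [[up pv vq qu] [[nuv uv] [npq pq]]]]] := sqr.
have cp : common u v p by split.
have cq : common u v q by split; exact: adj_sym.
have [[pu vp] [qv uq]] := ((adj_sym up, adj_sym pv), (adj_sym vq, adj_sym qu)).
pose sq (i : square_graph) : G :=
  match val i with 0 => u | 1 => p | 2 => v | _ => q end.
have nsym (x y : G) : ~ adj x y -> ~ adj y x by move=> xy /adj_sym.
have neq (x y : G) : adj x y -> x <> y by move=> /[swap] -> /adj_irr.
have sq_adj i j : adj i j <-> adj (sq i) (sq j).
{ rewrite square_adjE /sq.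
  case: i j => [[|[|[|[|i]]]] ?] // [[|[|[|[|j]]]] ?] //=; split=> // H; exfalso.
  all: move: H.
  all: by first [exact: adj_irr|exact: uv|exact: nsym uv|exact: pq|exact: nsym pq]. }
have sq_inj : injective sq.
{ have [[nup npv] [nvq nqu]] := ((neq _ _ up, neq _ _ pv), (neq _ _ vq, neq _ _ qu)).
  move=> i j ij; apply: val_inj.
  case: i j ij => [[|[|[|[|i]]]] ?] // [[|[|[|[|j]]]] ?] //=; rewrite /sq /= => e.
  all: by match goal with H : ?x <> ?y |- _ =>
    first [case: (H e) | case: (H (esym e))] end. }
have sqE w : w = u \/ w = v \/ w = p \/ w = q <-> exists i, sq i = w.
  split.
    case=> [->|[->|[->|->]]].
    - by exists (Ordinal (isT : 0 < 4)).
    - by exists (Ordinal (isT : 2 < 4)).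
    - by exists (Ordinal (isT : 1 < 4)).
    - by exists (Ordinal (isT : 3 < 4)).
  by move=> [[[|[|[|[|i]]]] ?]] // <-; rewrite /sq /=; tauto.
have [[r [cr [nrp nrq]]]|no_r] :=
    pselect (exists r, common u v r /\ r <> p /\ r <> q); last first.
  constructor 1; apply: (@induced_iso _ _ sq) => // w.
  rewrite (interval2 _ d2) -sqE; split.
    case=> [->|->|cw]; [tauto|tauto|].
    have [->|nwp] := pselect (w = p); first by tauto.
    have [->|nwq] := pselect (w = q); first by tauto.
    by case: no_r; exists w.
  by case=> [->|[->|[->|->]]];
      [constructor 1|constructor 2|constructor 3|constructor 3].
have middle r' : common u v r' -> r' <> p -> r' <> q -> adj p r' /\ adj q r'.
  move=> cr' np nq; split.
    by have [_] := gf p q r' cp cq cr' npq (nesym nq) (nesym np); apply.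
  have [_] := gf q p r' cq cp cr' (nesym npq) (nesym np) (nesym nq).
  by apply=> /adj_sym.
have hub r' : common u v r' -> r' <> p -> r' <> q -> forall i, adj r' (sq i).
  move=> cr' np nq; have [pr qr] := middle r' cr' np nq.
  have [ur rv] := cr'.
  by move=> [[|[|[|[|i]]]] ?] //=; exact: adj_sym.
have hub_neq r' : common u v r' -> r' <> p -> r' <> q -> forall i, r' <> sq i.
  by move=> cr' np nq i; apply: neq; exact: hub.
have [[s [cs [nsp [nsq nsr]]]]|no_s] :=
    pselect (exists s, common u v s /\ s <> p /\ s <> q /\ s <> r); last first.
  constructor 2.
  apply: (@induced_iso _ _ (fun x : pyramid_graph => if x is Some i then sq i else r)).
  - move=> w; rewrite (interval2 _ d2); split.
      move=> w_in; have [->|nwr] := pselect (w = r); first by exists None.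
      have /sqE [i iw] : w = u \/ w = v \/ w = p \/ w = q.
        case: w_in => [->|->|cw]; [tauto|tauto|].
        have [->|nwp] := pselect (w = p); first by tauto.
        have [->|nwq] := pselect (w = q); first by tauto.
        by case: no_s; exists w.
      by exists (Some i).
    move=> [[i iw|<-]]; last by constructor 3.
    have /sqE : exists i, sq i = w by exists i.
    by case=> [->|[->|[->|->]]];
      [constructor 1|constructor 2|constructor 3|constructor 3].
  - move=> [i|] [j|] //; first by move=> /sq_inj ->.
      by move=> e; case: (hub_neq r cr nrp nrq i).
    by move=> e; case: (hub_neq r cr nrp nrq j).
  - move=> [i|] [j|] /=; first exact: sq_adj.
    + by split=> // _; apply: adj_sym; exact: hub.
    + by split=> // _; exact: hub.
    + by split=> // /adj_irr.
have nrs : ~ adj r s.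
  have [pr _] := middle r cr nrp nrq; have [ps _] := middle s cs nsp nsq.
  have [tri _] := gf p r s cp cr cs (nesym nrp) (nesym nsr) (nesym nsp).
  by move=> rs; apply: tri.
have no_t t : common u v t -> t <> p -> t <> q -> t <> r -> t <> s -> False.
  move=> ct ntp ntq ntr nts.
  have [pr _] := middle r cr nrp nrq; have [ps _] := middle s cs nsp nsq.
  have [pt _] := middle t ct ntp ntq.
  have [_ /(_ nrs) rt] := gf r s t cr cs ct (nesym nsr) (nesym nts) (nesym ntr).
  by have [tri _] := gf p r t cp cr ct (nesym nrp) (nesym ntr) (nesym ntp); apply: tri.
constructor 3.
pose oct (x : octahedron_graph) : G :=
  match val x.1, x.2 with
  | 0, true => u | 0, false => v | 1, true => p | 1, false => q
  | _, true => r | _, false => s end.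
have [[ur rv] [us sv]] := (cr, cs).
have [pr qr] := middle r cr nrp nrq; have [ps qs] := middle s cs nsp nsq.
have oct_adj x y : adj x y <-> adj (oct x) (oct y).
{ rewrite /= /octahedron_adj /oct.
  case: x y => [[[|[|[|i]]] i3] [|]] // [[[|[|[|j]]] j3] [|]] //=.
  all: split=> [ij|ij]; try by [|exact: adj_sym]; try by case: ij; apply: val_inj.
  all: try by move=> /(congr1 val).
  all: exfalso; move: ij.
  all: by first [exact: adj_irr|exact: uv|exact: nsym uv|exact: pq|exact: nsym pq
    |exact: nrs|exact: nsym nrs]. }
apply: (@induced_iso _ _ oct) => //.
{ move=> w; rewrite (interval2 _ d2); split.
    case=> [->|->|cw].
    + by exists (Ordinal (isT : 0 < 3), true).
    + by exists (Ordinal (isT : 0 < 3), false).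
    have [->|nwp] := pselect (w = p); first by exists (Ordinal (isT : 1 < 3), true).
    have [->|nwq] := pselect (w = q); first by exists (Ordinal (isT : 1 < 3), false).
    have [->|nwr] := pselect (w = r); first by exists (Ordinal (isT : 2 < 3), true).
    have [->|nws] := pselect (w = s); first by exists (Ordinal (isT : 2 < 3), false).
    by case: (no_t w cw).
  move=> [[[[|[|[|i]]] i3] [|]]] // <-; rewrite /oct /=.
  all: by [constructor 1|constructor 2|constructor 3]. }
move=> x y xy; have [xy1|/eqP xy1] := eqVneq x.1 y.1; last first.
  have : adj x y by exact: xy1.
  by rewrite oct_adj xy => /adj_irr.
case: x y xy1 xy => [[[|[|[|i]]] i3] [|]] // [[[|[|[|j]]] j3] [|]] //.
all: rewrite /oct /= => xy1 xy; try by move: xy1 => /(congr1 val).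
all: try by congr pair; exact: val_inj.
all: try by case: nuv.
all: try by case: npq.
all: by case: nsr.
Qed.

End IntervalCondition.

(** * Differences of finite sets *)

Section JohnsonDistance.
Variable I : finType.
Implicit Types (A B P Q S T : {set I}) (i : I).

(** Equality of multiset sums. It makes differences with a fixed set additive
    ([balanced_card_setD]). *)
Definition balanced A B P Q :=
  forall i, (i \in A) + (i \in B) = (i \in P) + (i \in Q).

Lemma card_setD_sym S T : #|S| = #|T| -> #|S :\: T| = #|T :\: S|.
Proof.
move=> ST; have := cardsID T S; have := cardsID S T.
by rewrite finset.setIC; lia.
Qed.

Lemma card_symdiff S T : #|S| = #|T| ->
  #|(S :\: T) :|: (T :\: S)| = (#|S :\: T|).*2.
Proof.
move=> ST; rewrite cardsU -(card_setD_sym ST) addnn.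
rewrite (_ : _ :&: _ = finset.set0) ?cards0 ?subn0 //.
by apply/finset.setP => i; rewrite !inE; case: (i \in S); case: (i \in T).
Qed.

Lemma card_setD_triangle T S P : #|S :\: P| <= #|S :\: T| + #|T :\: P|.
Proof.
apply: leq_trans (leq_card_setU _ _); apply/subset_leq_card/fintype.subsetP => i.
by rewrite !inE; case: (i \in T); case: (i \in S); case: (i \in P).
Qed.

(** Equality in the triangle inequality places [P] between the meet and the join
    of [S] and [T]. *)
Lemma card_setD_between S P T : #|S :\: P| + #|P :\: T| = #|S :\: T| ->
  S :&: T \subset P /\ P \subset S :|: T.
Proof.
have := cardsID T (S :\: P); have := cardsID S (P :\: T).
have le : #|S :\: T| <= #|(S :\: P) :\: T| + #|(P :\: T) :&: S|.
  apply: leq_trans (leq_card_setU _ _); apply/subset_leq_card/fintype.subsetP => i.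
  by rewrite !inE; case: (i \in T); case: (i \in S); case: (i \in P).
move=> e1 e2 e.
have /eqP : #|(S :\: P) :&: T| = 0 by lia.
have /eqP : #|(P :\: T) :\: S| = 0 by lia.
rewrite !cards_eq0 => /eqP/finset.setP PT0 /eqP/finset.setP ST0.
by split; apply/fintype.subsetP => i; have := PT0 i; have := ST0 i; rewrite !inE;
  case: (i \in T); case: (i \in S); case: (i \in P).
Qed.

Lemma balanced_card_setD S A B P Q : balanced A B P Q ->
  #|S :\: A| + #|S :\: B| = #|S :\: P| + #|S :\: Q|.
Proof.
have sum T : #|S :\: T| + \sum_(i in S) (i \in T) = #|S|.
  rewrite -(cardsID T S) addnC; congr (_ + _).
  rewrite -[RHS]sum1_card [RHS](eq_bigl (fun i => (i \in S) && (i \in T))); last first.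
    by move=> i; rewrite inE.
  by rewrite [RHS]big_mkcondr; apply: eq_bigr => i _; case: (i \in T).
move=> bal; have : \sum_(i in S) (i \in A) + \sum_(i in S) (i \in B) =
    \sum_(i in S) (i \in P) + \sum_(i in S) (i \in Q).
  by rewrite -!big_split /=; apply: eq_bigr => i _; exact: bal.
by have := sum A; have := sum B; have := sum P; have := sum Q; lia.
Qed.

(** Both pairs of opposite corners have the same meet and the same join. *)
Lemma square_balanced A B P Q : #|A| = #|B| -> #|A| = #|P| -> #|A| = #|Q| ->
  #|A :\: P| = 1 -> #|P :\: B| = 1 -> #|B :\: Q| = 1 -> #|Q :\: A| = 1 ->
  #|A :\: B| = 2 -> #|P :\: Q| = 2 -> balanced A B P Q.
Proof.
move=> AB AP AQ dAP dPB dBQ dQA dAB dPQ i.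
have dPA : #|P :\: A| = 1 by rewrite card_setD_sym // -AP.
have dAQ : #|A :\: Q| = 1 by rewrite card_setD_sym // -AP.
have dQB : #|Q :\: B| = 1 by rewrite card_setD_sym // -AQ.
have [/fintype.subsetP a1 /fintype.subsetP a2] : A :&: B \subset P /\ P \subset A :|: B.
  by apply: card_setD_between; lia.
have [/fintype.subsetP b1 /fintype.subsetP b2] : A :&: B \subset Q /\ Q \subset A :|: B.
  by apply: card_setD_between; lia.
have [/fintype.subsetP c1 /fintype.subsetP c2] : P :&: Q \subset A /\ A \subset P :|: Q.
  by apply: card_setD_between; lia.
have [/fintype.subsetP d1 /fintype.subsetP d2] : P :&: Q \subset B /\ B \subset P :|: Q.
  by apply: card_setD_between; lia.
move: (a1 i) (a2 i) (b1 i) (b2 i) (c1 i) (c2 i) (d1 i) (d2 i); rewrite !inE.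
by case: (i \in A); case: (i \in B); case: (i \in P); case: (i \in Q) => //= *; lia.
Qed.

Lemma exchangeP S T a : #|S| = #|T| -> #|S :\: T| = 1 -> a \in S :\: T ->
  exists2 b, b \in T :\: S & T = (S :\ a) :|: [set b]%SET.
Proof.
move=> ST /eqP/cards1P [a' STa]; rewrite STa inE => /eqP aa'; subst a'.
have /eqP/cards1P [b TSb] : #|T :\: S| = 1 by rewrite -card_setD_sym // STa cards1.
exists b; first by rewrite TSb inE.
apply/finset.setP => i; have /finset.setP/(_ i) := STa.
have /finset.setP/(_ i) := TSb; rewrite !inE.
by case: (i \in S); case: (i \in T); case: (i == a); case: (i == b).
Qed.

Lemma card_exchange S a b : a \in S -> b \notin S ->
  #|(S :\ a) :|: [set b]%SET| = #|S|.
Proof.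
move=> aS bS; rewrite finset.setUC cardsU1 !inE (negbTE bS) andbF.
by rewrite (cardsD1 a S) aS.
Qed.

End JohnsonDistance.

(** * Basis graphs satisfy the conditions *)

Section JohnsonEmbedding.
Variables (G : sgraph) (I : finType) (lam : G -> {set I}).
Hypothesis conn : graph_connected G.
Hypothesis lam_card : forall u v, #|lam u| = #|lam v|.
Hypothesis lam_dist : forall u v, dist u v = #|lam u :\: lam v|.

Lemma embedded_positioning : positioning_condition G.
Proof.
move=> v u1 u2 u3 u4 [[a12 a23 a34 a41] [[n13 na13] [n24 na24]]].
rewrite !lam_dist; apply: balanced_card_setD.
apply: square_balanced; rewrite -?lam_dist //; try exact/(dist1 conn).
  exact: (dist2 conn a12).
exact: (dist2 conn a23).
Qed.

Hypothesis exchange : forall u v a, a \in lam u :\: lam v ->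
  exists w, exists2 b, b \in lam v :\: lam u &
    lam w = (lam u :\ a) :|: [set b]%SET.

(** A single exchange from [u] towards [v] ends in a common neighbour. *)
Lemma exchange_common u v x : dist u v = 2 -> x \in lam u :\: lam v ->
  exists2 w, common u v w & x \notin lam w.
Proof.
move=> d2 xuv; have [w [y yvu wE]] := exchange xuv.
have [xu xv] : x \in lam u /\ x \notin lam v by move: xuv; rewrite inE => /andP[].
have [yv yu] : y \in lam v /\ y \notin lam u by move: yvu; rewrite inE => /andP[].
have xy : x != y by apply: contraNneq yu => <-.
exists w; last by rewrite wE !inE eqxx.
have duw : dist u w = 1.
  rewrite lam_dist wE (_ : _ :\: _ = [set x]%SET) ?cards1 //.
  apply/finset.setP => i; rewrite !inE; have [->|_] /= := eqVneq i x.
    by rewrite xu xy.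
  by case: (i \in lam u); rewrite ?orbT ?andbF.
split; first exact/(dist1 conn).
apply/(dist1 conn); have := dist_triangle conn w u v.
suff : dist w v < dist u v by lia.
rewrite !lam_dist (cardsD1 x (lam u :\: lam v)) xuv ltnS.
apply/subset_leq_card/fintype.subsetP => i; rewrite wE !inE.
have [->|_] := eqVneq i y; first by rewrite yv.
by rewrite orbF => /and3P[-> -> ->].
Qed.

Section TwoApart.
Variables (u v : G) (a b c d : I).
Hypothesis ab : a != b.
Hypothesis cd : c != d.
Hypothesis uDv : lam u :\: lam v = [set a; b]%SET.
Hypothesis vDu : lam v :\: lam u = [set c; d]%SET.

(** A common neighbour contains exactly one of [a], [b] and one of [c], [d], and
    agrees with [u] elsewhere: it is a cell of a two-by-two grid, and the distance
    of two cells is their Hamming distance ([common_dist]). *)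
Lemma common_corner w : common u v w ->
  [/\ forall i, i != a -> i != b -> i != c -> i != d ->
        (i \in lam w) = (i \in lam u),
      (b \in lam w) = (a \notin lam w) & (d \in lam w) = (c \notin lam w)].
Proof.
move=> [uw wv].
have duw : #|lam u :\: lam w| = 1 by rewrite -lam_dist; apply/(dist1 conn).
have dwv : #|lam w :\: lam v| = 1 by rewrite -lam_dist; apply/(dist1 conn).
have dvw : #|lam v :\: lam w| = 1.
  by rewrite -lam_dist; apply/(dist1 conn)/adj_sym.
have [/fintype.subsetP sub /fintype.subsetP sup] :
    lam u :&: lam v \subset lam w /\ lam w \subset lam u :|: lam v.
  by apply: card_setD_between; rewrite uDv cards2 ab duw dwv.
have mem i : i \in [set a; b]%SET = (i \in lam u) && (i \notin lam v).
  by rewrite -uDv inE andbC.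
have mem' i : i \in [set c; d]%SET = (i \in lam v) && (i \notin lam u).
  by rewrite -vDu inE andbC.
have one (S : {set I}) x y : #|S :\: lam w| = 1 -> x != y -> x \in S -> y \in S ->
    (x \in lam w) || (y \in lam w).
  move=> S1 xy xS yS; apply: contraT; rewrite negb_or => /andP[xw yw].
  have : [set x; y]%SET \subset S :\: lam w.
    by apply/fintype.subsetP => i; rewrite !inE => /orP[] /eqP ->; rewrite ?xw ?yw.
  by move=> /subset_leq_card; rewrite S1 cards2 xy.
have notboth (S : {set I}) x y : #|lam w :\: S| = 1 -> x != y ->
    x \notin S -> y \notin S ->
    ~~ ((x \in lam w) && (y \in lam w)).
  move=> S1 xy xS yS; apply: contraT; rewrite negbK => /andP[xw yw].
  have : [set x; y]%SET \subset lam w :\: S.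
    apply/fintype.subsetP => i.
    by rewrite !inE => /orP[] /eqP ->; rewrite ?xw ?yw ?xS ?yS.
  by move=> /subset_leq_card; rewrite S1 cards2 xy.
have dwu : #|lam w :\: lam u| = 1.
  by rewrite -lam_dist; apply/(dist1 conn)/adj_sym.
have /andP[au av] : (a \in lam u) && (a \notin lam v) by rewrite -mem !inE eqxx.
have /andP[bu bv] : (b \in lam u) && (b \notin lam v).
  by rewrite -mem !inE eqxx orbT.
have /andP[cv cu] : (c \in lam v) && (c \notin lam u) by rewrite -mem' !inE eqxx.
have /andP[dv du] : (d \in lam v) && (d \notin lam u).
  by rewrite -mem' !inE eqxx orbT.
split.
- move=> i ia ib ic id; have := sub i; have := sup i.
  have := mem i; have := mem' i.
  rewrite !inE (negbTE ia) (negbTE ib) (negbTE ic) (negbTE id) /=.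
  by case: (i \in lam u); case: (i \in lam v); case: (i \in lam w) => //= _ _ h h';
    first [by have := h isT|by have := h' isT].
- have := one (lam u) a b duw ab au bu; have := notboth (lam v) a b dwv ab av bv.
  by case: (a \in lam w); case: (b \in lam w).
- have := one (lam v) c d dvw cd cv dv; have := notboth (lam u) c d dwu cd cu du.
  by case: (c \in lam w); case: (d \in lam w).
Qed.

Lemma common_dist w w' : common u v w -> common u v w' ->
  dist w w' = ((a \in lam w) != (a \in lam w')) + ((c \in lam w) != (c \in lam w')).
Proof.
move=> cw cw'; have [out wb wd] := common_corner cw.
have [out' wb' wd'] := common_corner cw'.
have dis x y : x \in lam u :\: lam v -> y \in lam v :\: lam u -> x != y.
  by rewrite !inE => /andP[_ xu] /andP[yu _]; apply: contraNneq yu => <-.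
have [ac ad] : a != c /\ a != d by split; apply: dis; rewrite ?uDv ?vDu !inE eqxx ?orbT.
have [bc bd] : b != c /\ b != d by split; apply: dis; rewrite ?uDv ?vDu !inE eqxx ?orbT.
rewrite lam_dist (cardsD1 a) (cardsD1 b) (cardsD1 c) (cardsD1 d).
rewrite (_ : _ :\ d = finset.set0) ?cards0; last first.
  apply/finset.setP => i; rewrite !inE.
  have [//|id] := eqVneq i d; have [//|ic] := eqVneq i c.
  have [//|ib] := eqVneq i b; have [//|ia] := eqVneq i a.
  by rewrite out // out' //=; case: (i \in lam u).
have neq (x y : I) : x != y -> (y == x) = false.
  by move=> xy; rewrite eq_sym (negbTE xy).
rewrite !inE (neq _ _ ab) (neq _ _ ac) (neq _ _ ad) (neq _ _ bc) (neq _ _ bd).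
rewrite (neq _ _ cd) wb wb' wd wd' /=.
by case: (a \in lam w); case: (a \in lam w'); case: (c \in lam w);
  case: (c \in lam w').
Qed.

Lemma common_inj w w' : common u v w -> common u v w' ->
  (a \in lam w) = (a \in lam w') -> (c \in lam w) = (c \in lam w') -> w = w'.
Proof.
move=> cw cw' ea ec; apply: (dist0 conn).
by rewrite common_dist // ea ec !eqxx.
Qed.

Lemma two_apart_one_gap : one_gap u v.
Proof.
move=> p q r cp cq cr npq nqr npr.
have pq := common_dist cp cq; have qr := common_dist cq cr.
have pr := common_dist cp cr.
rewrite -!(dist1 conn) pq qr pr.
have ipq := common_inj cp cq; have iqr := common_inj cq cr.
have ipr := common_inj cp cr.
move: ipq iqr ipr; case: (a \in lam p); case: (a \in lam q); case: (a \in lam r);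
  case: (c \in lam p); case: (c \in lam q); case: (c \in lam r) => /= ipq iqr ipr.
all: try by case: (npq (ipq erefl erefl)).
all: try by case: (nqr (iqr erefl erefl)).
all: try by case: (npr (ipr erefl erefl)).
all: by split=> // -[? []].
Qed.

(** Exchanges from both sides fill every row and every column of the grid, so some
    diagonal is filled. *)
Lemma two_apart_square : exists p q, is_square u p v q.
Proof.
have d2 : dist u v = 2 by rewrite lam_dist uDv cards2 ab.
have dvu : dist v u = 2 by rewrite (distC conn).
have [nuv nadj] := dist2P conn d2.
have opposite w w' : common u v w -> common u v w' ->
    (a \in lam w) != (a \in lam w') -> (c \in lam w) != (c \in lam w') ->
    exists p q, is_square u p v q.
  move=> cw cw' na nc; exists w, w'; have dw := common_dist cw cw'.
  have {}dw : dist w w' = 2 by rewrite dw na nc.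
  have [nww' aww'] := dist2P conn dw.
  by case: cw cw' => [? ?] [? ?]; split; [split=> //; exact: adj_sym|].
have from_u x : x \in lam u :\: lam v -> exists2 w, common u v w & x \notin lam w.
  exact: exchange_common.
have from_v x : x \in lam v :\: lam u -> exists2 w, common u v w & x \notin lam w.
  move=> /(exchange_common dvu) [w [vw wu] xw]; exists w => //.
  by split; exact: adj_sym.
have [|w1 c1 a1] := from_u a; first by rewrite uDv !inE eqxx.
have [|w2 c2 b2] := from_u b; first by rewrite uDv !inE eqxx orbT.
have [|w3 c3 c3n] := from_v c; first by rewrite vDu !inE eqxx.
have [|w4 c4 d4] := from_v d; first by rewrite vDu !inE eqxx orbT.
have [_ b2E _] := common_corner c2; have [_ _ d4E] := common_corner c4.
rewrite b2E negbK in b2; rewrite d4E negbK in d4.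
have [e|ne] := eqVneq (c \in lam w1) (c \in lam w2); last first.
  by apply: (opposite w1 w2) => //; rewrite (negbTE a1) b2.
have [w cw cwn] : exists2 w, common u v w & (c \in lam w) != (c \in lam w1).
  case: (c \in lam w1); first by exists w3; rewrite // (negbTE c3n).
  by exists w4; rewrite // d4.
have [aw|aw] := boolP (a \in lam w).
  by apply: (opposite w1 w); rewrite // 1?eq_sym // (negbTE a1) aw.
by apply: (opposite w2 w); rewrite // -?e 1?eq_sym // ?b2 (negbTE aw).
Qed.

End TwoApart.

Lemma embedded_diagonal (u v : G) : dist u v = 2 -> diagonal_condition u v.
Proof.
move=> d2; have : dist v u = 2 by rewrite (distC conn).
move: (d2); rewrite !lam_dist => /eqP/cards2P [a [b [ab uv]]].
move=> /eqP/cards2P [c [d [cd vu]]].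
by split; [exact: (two_apart_square ab cd uv vu)
  |exact: (two_apart_one_gap ab cd uv vu)].
Qed.

End JohnsonEmbedding.

Section Bases.
Variables (I : finType) (M : matroid I).
Implicit Types A B : basis_graph M.

Lemma bases_exchangeP (A B : {set I}) a :
  A \in bases M -> B \in bases M -> a \in A :\: B ->
  exists A' : {set I}, exists2 b, b \in B :\: A &
    [/\ A' \in bases M, A' = (A :\ a) :|: [set b]%SET,
        #|A'| = #|A|, #|A :\: A'| = 1 & #|A' :\: B| = #|A :\: B|.-1].
Proof.
move=> Ab Bb aAB; have [b bBA A'b] := bases_exchange Ab Bb aAB.
have [aA aB] : a \in A /\ a \notin B by move: aAB; rewrite inE => /andP[].
have [bB bA] : b \in B /\ b \notin A by move: bBA; rewrite inE => /andP[].
exists ((A :\ a) :|: [set b]%SET), b => //; split=> //.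
- exact: card_exchange.
- rewrite (_ : _ :\: _ = [set a]%SET) ?cards1 //.
  apply/finset.setP => i; rewrite !inE; have [->|_] /= := eqVneq i a.
    by rewrite aA andbT; apply: contraNneq bA => <-.
  by case: (i \in A); rewrite ?orbT ?andbF.
- rewrite (cardsD1 a (A :\: B)) aAB /=; congr (#|pred_of_set _|).
  apply/finset.setP => i; rewrite !inE.
  have [->|] := eqVneq i b; first by rewrite bB /= andbF.
  by rewrite orbF; case: (i == a); case: (i \in A); case: (i \in B).
Qed.

Lemma bases_card (A B : {set I}) : A \in bases M -> B \in bases M -> #|A| = #|B|.
Proof.
have [n] := ubnP #|A :\: B|; elim: n A B => // n IHn A B ltn Ab Bb.
have [AB0|[a aAB]] := finset.set_0Vmem (A :\: B); last first.
  have [A' [b _ [A'b _ <- _ A'B]]] := bases_exchangeP Ab Bb aAB.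
  apply: IHn => //; rewrite A'B.
  by move: ltn; rewrite (cardsD1 a) aAB /=; lia.
have [BA0|[b bBA]] := finset.set_0Vmem (B :\: A).
  congr (#|pred_of_set _|); apply/eqP; rewrite finset.eqEsubset.
  by rewrite -!finset.setD_eq0 AB0 BA0 eqxx.
have [a aAB _] := bases_exchange Bb Ab bBA.
by move: aAB; rewrite AB0 inE.
Qed.

Lemma basis_adjP A B : adj A B <-> #|val A :\: val B| = 1.
Proof.
rewrite /= /basis_adj card_symdiff; last exact: bases_card (valP A) (valP B).
by split=> [e|->//]; exact: double_inj.
Qed.

Lemma basis_walk A B : walk #|val A :\: val B| A B.
Proof.
have [n nE] : exists n, n = #|val A :\: val B| by eexists.
rewrite -nE; elim: n A nE => [|n IHn] A nE.
  apply: val_inj; apply/eqP; rewrite finset.eqEcard.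
  rewrite -finset.setD_eq0 -cards_eq0 -nE eqxx /=.
  by rewrite (bases_card (valP A) (valP B)).
have [AB0|[a aAB]] := finset.set_0Vmem (val A :\: val B).
  by move: nE; rewrite AB0 cards0.
have [A' [b _ [A'b _ _ dAA' A'B]]] := bases_exchangeP (valP A) (valP B) aAB.
exists (exist _ A' A'b); first exact/basis_adjP.
by apply: IHn; rewrite A'B -nE.
Qed.

Lemma basis_connected : graph_connected (basis_graph M).
Proof. by move=> A B; exists #|val A :\: val B|; exact: basis_walk. Qed.

Lemma basis_dist A B : dist A B = #|val A :\: val B|.
Proof.
have conn := basis_connected.
apply/eqP; rewrite eqn_leq dist_min //=; last exact: basis_walk.
move: (dist A B) (dist_walk conn A B) => n; elim: n A => [|n IHn] A.
  by move=> ->; rewrite finset.setDv cards0.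
move=> [C /basis_adjP AC /IHn CB].
by apply: leq_trans (card_setD_triangle (val C) _ _) _; rewrite AC.
Qed.

End Bases.

Lemma iso_walk (G H : sgraph) (f : G -> H) :
  bijective f -> (forall u v, adj u v <-> adj (f u) (f v)) ->
  forall n u v, walk n u v <-> walk n (f u) (f v).
Proof.
move=> [g fK gK] fadj; elim=> [|n IHn] u v /=.
  by split=> [->|/(can_inj fK)].
split=> -[w uw wv]; first by exists (f w); [exact/fadj|exact/IHn].
by exists (g w); [apply/fadj; rewrite gK|apply/IHn; rewrite gK].
Qed.

Lemma iso_dist (G H : sgraph) (f : G -> H) :
  bijective f -> (forall u v, adj u v <-> adj (f u) (f v)) ->
  forall u v, dist u v = dist (f u) (f v).
Proof.
move=> fb fadj u v; rewrite /dist; congr xget; apply/funext => n; apply/propext.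
split=> -[nw min]; split.
- exact/(iso_walk fb fadj).
- by move=> m /(iso_walk fb fadj); exact: min.
- exact/(iso_walk fb fadj).
- by move=> m /(iso_walk fb fadj); exact: min.
Qed.

Lemma basis_graph_conditions (G : sgraph) (I : finType) (M : matroid I) :
  isomorphic G (basis_graph M) ->
  graph_connected G /\ interval_condition G /\ positioning_condition G /\
   exists v : G, finite_set (neighbors v).
Proof.
move=> [f fb fadj]; have [g fK gK] := fb.
have conn : graph_connected G.
  move=> u v; have [n nw] := basis_connected (f u) (f v).
  by exists n; exact/(iso_walk fb fadj).
pose lam u := val (f u).
have lam_card u v : #|lam u| = #|lam v| by exact: bases_card (valP _) (valP _).
have lam_dist u v : dist u v = #|lam u :\: lam v|.
  by rewrite (iso_dist fb fadj) basis_dist.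
split=> //; split; last split.
- apply: diagonal_interval => //; apply: (embedded_diagonal conn lam_dist).
  move=> u v a /(bases_exchangeP (valP (f u)) (valP (f v))).
  move=> [A [b bvu [Ab AE _ _ _]]]; exists (g (exist _ A Ab)), b => //.
  by rewrite /lam gK.
- exact: embedded_positioning lam_card lam_dist.
have [A Ab] := bases_nonempty M.
exists (g (exist _ A Ab)).
apply: (@sub_finite_set _ _ (f @^-1` setT)%classic) => //.
apply: finite_preimage; first by move=> u v _ _; exact: (can_inj fK).
exact: finite_finset.
Qed.

(** * The triangle condition and the link of a vertex *)

Section Link.
Variable G : sgraph.
Hypothesis conn : graph_connected G.
Hypothesis diag : forall u v : G, dist u v = 2 -> diagonal_condition u v.
Hypothesis pos : positioning_condition G.
Implicit Types (u v w b s t p q r x : G) (K : set G).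

Lemma adj_neq u v : adj u v -> u <> v.
Proof. by move=> /[swap] -> /adj_irr. Qed.

Lemma dist2_square u v : dist u v = 2 -> exists p q, is_square u p v q.
Proof. by move=> /diag []. Qed.

Lemma square_dist2 u p v q : is_square u p v q -> dist u v = 2 /\ dist p q = 2.
Proof.
move=> [[up pv vq qu] [[nuv uv] [npq pq]]]; split; first exact: (dist2 conn up).
exact: (dist2 conn pv).
Qed.

Lemma square_rot u p v q : is_square u p v q -> is_square p v q u.
Proof.
move=> [[up pv vq qu] [[nuv uv] npq]]; split=> //; split=> //.
by split; [exact: nesym | move=> /adj_sym].
Qed.

Lemma square_flip u p v q : is_square u p v q -> is_square u q v p.
Proof.
move=> [[up pv vq qu] [nuv [npq pq]]]; split; first by split; exact: adj_sym.
by split=> //; split; [exact: nesym | move=> /adj_sym].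
Qed.

(** Take a neighbour [v'] of [v] closer to [x]. If [u] misses it, a square between
    [u] and [v'] has a corner [P] closer to [x] by the positioning condition, and
    induction gives [r] closer still over the edge from [P] to [v']. A square
    between [u] and [r], positioned from [v], has a corner that is adjacent to
    [v]. *)
Lemma triangle_condition x u v k : adj u v -> dist x u = k.+1 ->
  dist x v = k.+1 -> exists t, [/\ adj u t, adj t v & dist x t = k].
Proof.
elim: k u v => [|k IHk] u v uv du dv.
  by exists x; split; [exact/adj_sym/(dist1 conn)|exact/(dist1 conn)|exact: distvv].
have [v' v'v dv'] := closer conn dv.
have [uv'|nuv'] := pselect (adj u v'); first by exists v'; split.
have d2 : dist u v' = 2.
  apply: (dist2 conn uv) => //; first exact: adj_sym.
  by move=> e; move: dv'; rewrite -e; lia.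
have [P [Q sq]] := dist2_square d2.
wlog dP : P Q sq / dist x P = k.+1.
  move=> wl; have := pos x sq; move: (sq) => [[up _ _ qu] _].
  have := dist_adj conn x up; have := dist_adj conn x (adj_sym qu).
  have [dP|dP] := eqVneq (dist x P) k.+1; first by move=> *; exact: (wl P Q).
  by move=> *; apply: (wl Q P); [exact: square_flip | lia].
move: (sq) => [[uP Pv' _ _] _].
have [r [Pr rv' dr]] := IHk _ _ Pv' dP dv'.
have far w : dist x w = k.+2 -> w <> r /\ ~ adj w r.
  move=> dw; split=> [e|wr]; first by move: dw; rewrite e; lia.
  by have := dist_adj conn x wr; lia.
have [nur ur] := far u du; have [nvr vr] := far v dv.
have dur : dist u r = 2 by exact: (dist2 conn uP).
have dvr : dist v r = 2 by apply: (dist2 conn (adj_sym v'v)) => //; exact: adj_sym.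
have [U [V sqr]] := dist2_square dur.
have dvu : dist v u = 1 by apply/(dist1 conn)/adj_sym.
wlog dU : U V sqr / dist v U = 1.
  move=> wl; have := pos v sqr; rewrite dvr dvu.
  case dU: (dist v U) => [|[|[|n]]].
  - by case: sqr => [[_ Ur _ _] _]; case: vr; rewrite (dist0 conn dU).
  - by move=> _; exact: (wl U V).
  - by move=> *; apply: (wl V U); [exact: square_flip|lia].
  - move=> dV; have V0 : dist v V = 0 by lia.
    by case: sqr => [[_ _ rV _] _]; case: vr; apply: adj_sym; rewrite (dist0 conn V0).
case: sqr => [[uU Ur _ _] _]; exists U; split=> //.
  by apply/adj_sym/(dist1 conn).
by have := dist_adj conn x Ur; have := dist_adj conn x uU; lia.
Qed.

(** The interval between two vertices at distance two has no triangle of common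
    neighbours. *)
Lemma no_diamond p q r s t : adj r s -> adj s t -> adj r t ->
  common p q r -> common p q s -> common p q t -> p = q \/ adj p q.
Proof.
move=> rs st rt cr cs ct.
have [->|npq] := pselect (p = q); first by left.
have [|pq] := pselect (adj p q); first by right.
have d2 : dist p q = 2 by case: cr => pr rq; exact: (dist2 conn pr).
have [_ gf] := diag d2.
by case: (gf r s t cr cs ct (adj_neq rs) (adj_neq st) (adj_neq rt)) => -[].
Qed.

(** In the square [b], [p], [c], [q] the positioning condition puts [r] at distance
    three from [c], but [s] is adjacent to both. *)
Lemma no_claw_corner b s p q r c : adj b r -> adj s r ->
  common p q b -> common p q s -> common p q c -> p <> q -> ~ adj p q ->
  p <> r -> ~ adj p r -> q <> r -> ~ adj q r ->
  adj s c -> b <> c -> ~ adj b c -> False.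
Proof.
move=> br sr [pb bq] [ps sq] [pc cq] npq pq npr pr nqr qr sc nbc bc.
have sqr : is_square b p c q.
  by split; [split=> //; exact: adj_sym|split].
have := pos r sqr.
have -> : dist r b = 1 by apply/(dist1 conn)/adj_sym.
have -> : dist r p = 2.
  by rewrite (distC conn); apply: (dist2 conn (adj_sym _) br) => //; exact: adj_sym.
have -> : dist r q = 2.
  by rewrite (distC conn); apply: (dist2 conn (adj_sym bq) br).
have := dist_adj conn r (adj_sym sc).
have -> : dist r s = 1 by apply/(dist1 conn)/adj_sym.
lia.
Qed.

(** Three pairwise non-adjacent common neighbours [p], [q], [r] of the edge from [b]
    to [s] are impossible: the interval between [p] and [q] contains, besides [b]
    and [s], a vertex missing one of them, where [no_claw_corner] applies. *)
Lemma no_claw b s p q r : adj b s -> adj b p -> adj b q -> adj b r ->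
  adj s p -> adj s q -> adj s r ->
  [\/ p = q \/ adj p q, p = r \/ adj p r | q = r \/ adj q r].
Proof.
move=> bs bp bq br sp sq sr.
have [|/not_orP[npq pq]] := pselect (p = q \/ adj p q); first by constructor 1.
have [|/not_orP[npr pr]] := pselect (p = r \/ adj p r); first by constructor 2.
have [|/not_orP[nqr qr]] := pselect (q = r \/ adj q r); first by constructor 3.
exfalso.
have d2 : dist p q = 2 by exact: (dist2 conn (adj_sym bp) bq).
have cb : common p q b by split=> //; exact: adj_sym.
have cs : common p q s by split=> //; exact: adj_sym.
have [[c [c' [[pc cq qc' c'p] [_ [ncc' cc']]]]] gf] := diag d2.
have cc : common p q c by split.
have cc'' : common p q c' by split; exact: adj_sym.
have nbs := adj_neq bs.
(* A vertex of the interval that misses one of [b] and [s] meets the other. *)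
have corner a a' e : common p q a -> common p q a' -> common p q e ->
    a <> e -> a' <> e -> adj a a' -> ~ adj a e -> adj a' e.
  move=> ca ca' ce nae na'e aa' ae.
  have [_ /(_ (fun ea => ae (adj_sym ea)))] :=
    gf e a a' ce ca ca' (nesym nae) (adj_neq aa') (nesym na'e).
  exact: adj_sym.
have kill a a' e : common p q a -> common p q a' -> common p q e ->
    adj a a' -> adj a r -> adj a' r -> a <> e -> ~ adj a e -> False.
  move=> ca ca' ce aa' ar a'r nae ae.
  have na'e : a' <> e by move=> e'; apply: ae; rewrite -e'.
  have a'e := corner _ _ _ ca ca' ce nae na'e aa' ae.
  exact: (no_claw_corner ar a'r ca ca' ce npq pq npr pr nqr qr a'e).
have full e : common p q e -> (b = e \/ adj b e) /\ (s = e \/ adj s e).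
  move=> ce; split; apply: contrapT => /not_orP[n1 n2].
    exact: (kill b s e).
  by apply: (kill s b e) => //; exact: adj_sym.
have [bc sc] := full c cc; have [bc' sc'] := full c' cc''.
case: bc => [e|bc]; first by case: bc' => [e'|]; [apply: ncc'; rewrite -e|rewrite e].
case: sc => [e|sc]; first by case: sc' => [e'|]; [apply: ncc'; rewrite -e|rewrite e].
by have [] := no_diamond bs sc bc cb cs cc.
Qed.

(** Ends are the maximal cliques of the link of [b] with at least two vertices;
    [end_closed] expresses maximality. *)
Record is_end b K : Prop := IsEnd {
  end_link : forall s, K s -> adj b s;
  end_clique : forall s t, K s -> K t -> s <> t -> adj s t;
  end_pair : exists s t, [/\ K s, K t & s <> t];
  end_closed : forall s t u, K s -> K t -> s <> t ->
    adj b u -> adj s u -> adj t u -> K u }.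

(** The maximal clique of the link of [b] through an edge of the link. *)
Definition edge_end b s t : set G :=
  [set u | adj b u /\ [\/ u = s, u = t | adj s u /\ adj t u]]%classic.

Lemma edge_end1 b s t : adj b s -> edge_end b s t s.
Proof. by split=> //; constructor 1. Qed.

Lemma edge_end2 b s t : adj b t -> edge_end b s t t.
Proof. by split=> //; constructor 2. Qed.

Lemma edge_endP b s t : adj b s -> adj b t -> adj s t -> is_end b (edge_end b s t).
Proof.
move=> bs bt st.
have clique u v : edge_end b s t u -> edge_end b s t v -> u <> v -> adj u v.
  move=> [bu hu] [bv hv] nuv; case: hu hv nuv => [->|->|[su tu]].
  - by case=> [->|->|[]].
  - by case=> [->|->|[]] // *; exact: adj_sym.
  case=> [->|->|[sv tv]] nuv; [exact: adj_sym|exact: adj_sym|].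
  have [//|//] : u = v \/ adj u v.
  by apply: (@no_diamond u v b s t) => //; split=> //; exact: adj_sym.
split=> //.
- by move=> u [].
- by exists s, t; split; [exact: edge_end1|exact: edge_end2|exact: adj_neq].
move=> u v w eu ev nuv bw uw vw; split=> //.
have uv := clique u v eu ev nuv.
have key x : adj b x -> edge_end b s t x -> w = x \/ adj x w.
  move=> bx ex.
  have [<-|nxu] := pselect (u = x); first by right.
  have [<-|nxv] := pselect (v = x); first by right.
  have [-> | /adj_sym ?] : w = x \/ adj w x; [|by left|by right].
  have ux := clique u x eu ex nxu; have vx := clique v x ev ex nxv.
  by apply: (@no_diamond w x b u v) => //; try (by split=> //; exact: adj_sym);
    case: eu ev => ? _ [].
case: (key s bs (edge_end1 _ bs)) => [->|sw]; first by constructor 1.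
case: (key t bt (edge_end2 _ bt)) => [->|tw]; first by constructor 2.
by constructor 3.
Qed.

(** By maximality, ends with two common vertices contain each other. *)
Lemma end_eq b K K' s t : is_end b K -> is_end b K' ->
  K s -> K t -> K' s -> K' t -> s <> t -> K = K'.
Proof.
move=> eK eK' Ks Kt K's K't nst; apply/funext => u; apply/propext.
have sub (L L' : set G) : is_end b L -> is_end b L' ->
    L s -> L t -> L' s -> L' t -> L u -> L' u.
  move=> eL eL' Ls Lt L's L't Lu.
  have [<-//|nsu] := pselect (s = u); have [<-//|ntu] := pselect (t = u).
  apply: (end_closed eL' L's L't nst); first exact: (end_link eL).
    exact: (end_clique eL).
  exact: (end_clique eL).
by split; exact: sub.
Qed.

Lemma end_other b K s : is_end b K -> K s -> exists2 t, K t & s <> t.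
Proof.
move=> eK Ks; have [t [t' [Kt Kt' ntt']]] := end_pair eK.
have [st|] := pselect (s = t); last by exists t.
by exists t' => // st'; apply: ntt'; rewrite -st.
Qed.

(** Three ends through [s] would give a claw centred at [s]. *)
Lemma two_ends b s K1 K2 K3 : is_end b K1 -> is_end b K2 -> is_end b K3 ->
  K1 s -> K2 s -> K3 s -> [\/ K1 = K2, K1 = K3 | K2 = K3].
Proof.
move=> e1 e2 e3 k1 k2 k3.
have [t1 kt1 n1] := end_other e1 k1.
have [t2 kt2 n2] := end_other e2 k2.
have [t3 kt3 n3] := end_other e3 k3.
have same K K' t t' : is_end b K -> is_end b K' -> K s -> K' s -> K t -> K' t' ->
    s <> t -> s <> t' -> t = t' \/ adj t t' -> K = K'.
  move=> eK eK' Ks K's Kt K't' nst nst' tt'; apply: (end_eq eK eK' Ks) (nst') => //.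
  case: tt' => [<-//|tt']; apply: (end_closed eK Ks Kt) => //.
    exact: (end_link eK').
  exact: (end_clique eK').
have [] := @no_claw b s t1 t2 t3.
- exact: (end_link e1).
- exact: (end_link e1).
- exact: (end_link e2).
- exact: (end_link e3).
- exact: (end_clique e1).
- exact: (end_clique e2).
- exact: (end_clique e3).
- by move=> h; constructor 1; exact: (same _ _ t1 t2).
- by move=> h; constructor 2; exact: (same _ _ t1 t3).
- by move=> h; constructor 3; exact: (same _ _ t2 t3).
Qed.

(** * Odd closed walks in the root graph of a link *)

Section EndGraph.
Variable b : G.

(** This is the root graph: the link of [b] is its line graph, up to vertices of
    degree one. *)
Definition end_adj K K' :=
  [/\ is_end b K, is_end b K', K <> K' & exists s, K s /\ K' s].

Fact end_adj_sym K K' : end_adj K K' -> end_adj K' K.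
Proof. by move=> [? ? ? [s []]]; split=> //; [exact: nesym|exists s]. Qed.

Fact end_adj_irr K : ~ end_adj K K. Proof. by case. Qed.

Definition end_graph : sgraph := SGraph end_adj_sym end_adj_irr.

(** Consecutive edges of a hole lie in different ends since the outer vertices of
    a path of length two are not adjacent. *)
Lemma hole_walk L (g : nat -> G) :
  (forall i, i <= L.+1 -> adj b (g i)) ->
  (forall i, i <= L -> adj (g i) (g i.+1)) ->
  (forall i, i < L -> g i <> g i.+2 /\ ~ adj (g i) (g i.+2)) ->
  g L = g 0 -> g L.+1 = g 1 ->
  exists K : end_graph, walk L K K.
Proof.
move=> bg gg far gL gL1.
pose e i : end_graph := edge_end b (g i) (g i.+1).
have eP i : i <= L -> is_end b (e i).
  by move=> iL; apply: edge_endP; [apply: bg; lia|apply: bg; lia|exact: gg].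
exists (e 0).
have eL : e L = e 0 by rewrite /e gL gL1.
rewrite -{2}eL -{1}(subn0 L); apply: (@walk_seq _ L) => // i iL.
have e2 : e i.+1 (g i.+2) by apply: edge_end2; exact: bg.
split; [apply: eP; lia|exact: eP| |].
  move=> ee; rewrite -ee in e2; have [ng ag] := far i iL.
  apply: ag; apply: (end_clique (eP i _)) => //; first by lia.
  by apply: edge_end1; apply: bg; lia.
by exists (g i.+1); split; [apply: edge_end2|apply: edge_end1]; apply: bg; lia.
Qed.

End EndGraph.

(** The cycle [h] of ends is isometric, as a shortest odd closed walk is, and [n i]
    is the vertex of the link in which [h i] and [h i.+1] meet. *)
Section Cycle.
Variables (b : G) (M : nat) (h : nat -> end_graph b) (n : nat -> G).
Hypothesis M5 : 5 <= M.
Hypothesis h_closed : h M = h 0.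
Hypothesis h_adj : forall i, i < M -> adj (h i) (h i.+1).
Hypothesis h_isometric : forall l i j, i <= j -> j <= M ->
  walk l (h i) (h j) -> j - i <= l \/ M - (j - i) <= l.
Hypothesis n_in : forall i, i < M -> h i (n i) /\ h i.+1 (n i).

Let h_end i : i <= M -> is_end b (h i).
Proof.
case: i => [|i] iM; first by have [] := h_adj (ltn_trans (isT : 0 < 4) M5).
by have [] := h_adj iM.
Qed.

Let h_neq i j : i < j -> j - i < M -> j <= M -> h i <> h j.
Proof.
move=> ij ijM jM e; have w0 : walk 0 (h i) (h j) by [].
by have [|] := h_isometric (ltnW ij) jM w0; lia.
Qed.

Lemma cycle_link i : i < M -> adj b (n i).
Proof. by move=> iM; have [hi _] := n_in iM; apply: (end_link (h_end (ltnW iM))). Qed.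

Lemma cycle_end i K : i < M -> is_end b K -> K (n i) -> K = h i \/ K = h i.+1.
Proof.
move=> iM eK Kn; have [hi hi1] := n_in iM.
have [||] := two_ends eK (h_end (ltnW iM)) (h_end iM) Kn hi hi1.
- by left.
- by right.
by have [_ _ nh _] := h_adj iM.
Qed.

Lemma cycle_step i : i.+1 < M -> adj (n i) (n i.+1).
Proof.
move=> iM; have [hi hi1] := n_in (ltnW iM); have [hi1' hi2] := n_in iM.
apply: (end_clique (h_end (ltnW iM))) => // e.
have [] := cycle_end (ltnW iM) (h_end iM); first by rewrite e.
  by move=> /esym; apply: h_neq; lia.
by move=> /esym; apply: h_neq; lia.
Qed.

Lemma cycle_wrap : adj (n 0) (n M.-1).
Proof.
have M0 : 0 < M by lia.
have M1 : M.-1 < M by lia.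
have [h0 h1] := n_in M0; have [hm hM] := n_in M1.
rewrite prednK // h_closed in hM.
apply: (end_clique (h_end (leq0n M))) => // e.
have [] := cycle_end M0 (h_end (ltnW M1)); first by rewrite e.
  by move=> /esym; apply: h_neq; lia.
by move=> /esym; apply: h_neq; lia.
Qed.

(** A common end of [n i] and [n j] would be visited twice by the cycle. *)
Lemma cycle_far i j : i.+1 < j -> j < M -> j - i <= M - 2 ->
  n i <> n j /\ ~ adj (n i) (n j).
Proof.
move=> ij jM far; have iM : i < M by lia.
have noK K : is_end b K -> K (n i) -> K (n j) -> False.
  move=> eK /(cycle_end iM eK) Ki /(cycle_end jM eK) Kj.
  have [a [Ka ai]] : exists a, K = h a /\ i <= a <= i.+1.
    by case: Ki => ->; eexists; split; try reflexivity; lia.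
  have [c [Kc cj]] : exists c, K = h c /\ j <= c <= j.+1.
    by case: Kj => ->; eexists; split; try reflexivity; lia.
  have : h a = h c by rewrite -Ka -Kc.
  by apply: h_neq; lia.
have [hi hi1] := n_in iM; split=> [e|aij].
  by apply: (noK (h i)) => //; [apply: h_end; lia|rewrite -e].
apply: (noK (edge_end b (n i) (n j))).
- by apply: edge_endP => //; exact: cycle_link.
- by apply: edge_end1; exact: cycle_link.
- by apply: edge_end2; exact: cycle_link.
Qed.

Lemma cycle_dist i j : i < j -> j < M ->
  dist (n i) (n j) = if (j == i.+1) || (j - i == M.-1) then 1 else 2.
Proof.
move=> ij jM; case: ifPn => [/orP[]/eqP e|].
- by apply/(dist1 conn); rewrite e; apply: cycle_step; lia.
- have [-> ->] : i = 0 /\ j = M.-1 by lia.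
  by apply/(dist1 conn)/cycle_wrap.
rewrite negb_or => /andP[/eqP ne1 /eqP ne2].
have [|||ne ae] := @cycle_far i j => //; try lia.
by apply: (dist2 conn (adj_sym (cycle_link _)) (cycle_link jM)) => //; lia.
Qed.

(** Otherwise two non-adjacent vertices of the link would be joined to both
    [n i] and [n j], and the ends through them would shortcut the cycle. *)
Lemma cycle_square i j : i.+1 < j -> j < M -> j - i <= M - 2 ->
  exists c, is_square b (n i) c (n j).
Proof.
move=> ij jM far; have iM : i < M by lia.
have [nij aij] := cycle_far ij jM far.
have bi := cycle_link iM; have bj := cycle_link jM.
have d2 : dist (n i) (n j) = 2 by exact: (dist2 conn (adj_sym bi) bj).
have [[P [Q sq]] gf] := diag d2.
have [[iP Pj jQ Qi] [_ [nPQ PQ]]] := sq.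
have [e|nbP] := pselect (b = P).
  by exists Q; rewrite e; apply/square_flip/square_rot.
have [e|nbQ] := pselect (b = Q).
  by exists P; rewrite e; apply/square_rot/square_rot/square_rot.
have cb : common (n i) (n j) b by split=> //; exact: adj_sym.
have cP : common (n i) (n j) P by split.
have cQ : common (n i) (n j) Q by split; exact: adj_sym.
have [_ /(_ PQ) /adj_sym bP] := gf P Q b cP cQ cb nPQ (nesym nbQ) (nesym nbP).
have [_ /(_ (fun qp => PQ (adj_sym qp))) /adj_sym bQ] :=
  gf Q P b cQ cP cb (nesym nPQ) (nesym nbP) (nesym nbQ).
exfalso.
pose a := if j == i.+2 then i.+1 else i.
have through R : adj b R -> common (n i) (n j) R -> h a R.
  move=> bR [iR Rj].
  have eKi : is_end b (edge_end b (n i) R) by exact: edge_endP.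
  have eKj : is_end b (edge_end b (n j) R) by exact: edge_endP bj bR (adj_sym Rj).
  have Ri : edge_end b (n i) R R by exact: edge_end2.
  have Rj' : edge_end b (n j) R R by exact: edge_end2.
  have Ki := cycle_end iM eKi (edge_end1 _ bi).
  have Kj := cycle_end jM eKj (edge_end1 _ bj).
  have [x [Kx xi]] : exists x : nat, edge_end b (n i) R = h x /\ i <= x <= i.+1.
    by case: Ki => ->; eexists; split; try reflexivity; lia.
  have [y [Ky yj]] : exists y, edge_end b (n j) R = h y /\ j <= y <= j.+1.
    by case: Kj => ->; eexists; split; try reflexivity; lia.
  rewrite Kx in eKi Ri; rewrite Ky in eKj Rj'.
  have [|] : y - x <= 1 \/ M - (y - x) <= 1.
  - have [xy|nxy] := pselect (h x = h y).
      have w0 : walk 0 (h x) (h y) by [].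
      have : y - x <= 0 \/ M - (y - x) <= 0 by apply: (h_isometric _ _ w0); lia.
      lia.
    have w1 : walk 1 (h x) (h y) by exists (h y) => //; split=> //; exists R.
    by apply: (h_isometric _ _ w1); lia.
  - by move=> yx; rewrite (_ : a = x) // /a; case: eqP; lia.
  - by move=> yx; rewrite (_ : a = x) // /a; case: eqP; lia.
have aM : a <= M by rewrite /a; case: ifP; lia.
by apply: PQ; apply: (end_clique (h_end aM)) => //; apply: through.
Qed.

(** The positioning condition computes every distance from a corner opposite to
    [b]. At [n 1] the corners over the other vertices of the hole form a new hole
    in which [D] replaces three consecutive vertices. *)
Section Pivot.
Variables (D : G) (c : nat -> G).
Hypothesis sqD : is_square b (n 0) D (n 2).
Hypothesis sqc : forall j, 2 < j -> j < M -> is_square b (n 1) (c j) (n j).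

Let n_b i : i < M -> dist (n i) b = 1.
Proof. by move=> iM; apply/(dist1 conn)/adj_sym/cycle_link. Qed.

Lemma pivot_hub_adj : adj (n 1) D.
Proof.
apply/(dist1 conn); have := pos (n 1) sqD.
rewrite n_b ?(distC conn (n 1) (n 0)) ?cycle_dist //=; lia.
Qed.

Lemma pivot_dist_hub j : 2 < j -> j < M ->
  dist D (c j) = if (j == 3) || (j == M.-1) then 1 else 2.
Proof.
move=> j3 jM; have := pos D (sqc j3 jM); have := pos (n j) sqD.
have [dbD _] := square_dist2 sqD; rewrite (distC conn D b) dbD n_b //.
rewrite (distC conn D (n 1)) (iffRL (dist1 conn _ _) pivot_hub_adj).
rewrite (distC conn (n j) (n 0)) (distC conn (n j) (n 2)) (distC conn D (n j)).
have j0 : 0 < j by lia.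
rewrite !cycle_dist //; case: ifP; case: ifP; case: ifP; lia.
Qed.

Lemma pivot_dist i j : 2 < i -> i < j -> j < M ->
  dist (c i) (c j) = if j == i.+1 then 1 else 2.
Proof.
move=> i3 ij jM; have iM := ltn_trans ij jM; have j3 := ltn_trans i3 ij.
have := pos (c i) (sqc j3 jM); have := pos (n j) (sqc i3 iM).
have [dbc _] := square_dist2 (sqc i3 iM); rewrite (distC conn (c i) b) dbc n_b //.
have [[_ nc _ _] _] := sqc i3 iM.
rewrite (distC conn (c i) (n 1)) (iffRL (dist1 conn _ _) nc).
rewrite (distC conn (n j) (n 1)) (distC conn (n j) (n i)) (distC conn (c i) (n j)).
have j1 : 1 < j by lia.
rewrite !cycle_dist //; case: ifP; case: ifP; case: ifP; lia.
Qed.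

Lemma pivot_adj j : 2 < j -> j < M -> adj (n 1) (c j).
Proof. by move=> j3 jM; have [[_ ? _ _] _] := sqc j3 jM. Qed.

Lemma pivot_shorter_walk : 7 <= M -> exists K : end_graph (n 1), walk (M - 2) K K.
Proof.
move=> M7.
pose g i := if (i == 0) || (i == M - 2) then D else
            if i == M - 1 then c 3 else c (i + 2).
have g0 : g 0 = D by [].
have gD : g (M - 2) = D by rewrite /g eqxx orbT.
have g1 : g (M - 1) = c 3.
  by rewrite /g eqxx; case: ifP => // /orP[] /eqP; lia.
have gc i : 0 < i -> i < M - 2 -> g i = c (i + 2).
  by move=> i0 iM; rewrite /g; case: ifP => [/orP[] /eqP|_]; [lia..|];
    case: eqP => //; lia.
have dist_adj1 u v : dist u v = 1 -> adj u v by move=> /(dist1 conn).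
have dist_far u v : dist u v = 2 -> u <> v /\ ~ adj u v by exact: (dist2P conn).
have D3 : dist D (c 3) = 1 by rewrite pivot_dist_hub //; lia.
have D_last : dist (c M.-1) D = 1.
  by rewrite (distC conn) pivot_dist_hub ?eqxx ?orbT //; lia.
have D_mid j : 3 < j -> j < M.-1 -> dist D (c j) = 2.
  by move=> j3 jM; rewrite pivot_dist_hub; [case: ifP => //; lia|lia|lia].
have cut i : i < M -> [\/ i = 0, 0 < i < M - 2, i = M - 2 | i = M - 1].
  move=> iM; have [->|i0] := posnP i; first by constructor 1.
  have [iM2|Mi] := ltnP i (M - 2); first by constructor 2.
  by have [?|?] := eqVneq i (M - 2); [constructor 3|constructor 4; lia].
apply: (@hole_walk _ _ g).
- move=> i iM; case: (@cut i) => [|->|/andP[i0 i2]|->|->]; first lia.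
  + exact: pivot_hub_adj.
  + by rewrite gc //; apply: pivot_adj; lia.
  + by rewrite gD; exact: pivot_hub_adj.
  + by rewrite g1; apply: pivot_adj; lia.
- move=> i iM; apply: dist_adj1.
  case: (@cut i) => [|->|/andP[i0 i2]|->|]; [lia| | | |lia].
  + by rewrite g0 gc //; lia.
  + rewrite gc //; have [e|ne] := eqVneq i (M - 3).
      rewrite (_ : i.+1 = M - 2) ?gD; last lia.
      by rewrite (_ : i + 2 = M.-1) //; lia.
    rewrite gc; [|lia|lia].
    by rewrite pivot_dist; [case: ifP => //; lia|lia..].
  + by rewrite gD (_ : (M - 2).+1 = M - 1) ?g1 //; lia.
- move=> i iM; apply: dist_far.
  case: (@cut i) => [|->|/andP[i0 i2]| |]; [lia| | |lia|lia].
  + by rewrite g0 gc; [apply: D_mid; lia|lia|lia].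
  + rewrite gc //; have [e|ne] := eqVneq i (M - 4).
      rewrite (_ : i.+2 = M - 2) ?gD; last lia.
      by rewrite (distC conn); apply: D_mid; lia.
    have [e|ne'] := eqVneq i (M - 3).
      rewrite (_ : i.+2 = M - 1) ?g1; last lia.
      by rewrite (distC conn) pivot_dist; [case: ifP => //; lia|lia..].
    rewrite gc; [|lia|lia].
    by rewrite pivot_dist; [case: ifP => //; lia|lia..].
- by rewrite gD.
- by rewrite (_ : (M - 2).+1 = M - 1) ?g1 ?gc //; lia.
Qed.

(** For a pentagon the new hole is a triangle, and its three vertices lie in the
    interval from [n 1] to the corner opposite to [b] over [n 2] and [n 4]. *)
Lemma pivot_pentagon : M = 5 -> False.
Proof.
move=> M5E.
have [E sqE] : exists E, is_square b (n 2) E (n 4) by apply: cycle_square; lia.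
have M4 : 4 < M by lia.
have M3 : 3 < M by lia.
have nE x : dist x b + dist x E = dist x (n 2) + dist x (n 4) by exact: pos sqE.
have nd i j : i < j -> j < M ->
    dist (n i) (n j) = if (j == i.+1) || (j - i == 4) then 1 else 2.
  by move=> ij jM; rewrite cycle_dist // M5E.
have n1E : dist (n 1) E = 2.
  have := nE (n 1); rewrite n_b ?nd //=; lia.
have DE : dist D E = 1.
  have [dbD _] := square_dist2 sqD.
  have := nE D; have := pos (n 4) sqD; rewrite (distC conn D b) dbD n_b //.
  rewrite (distC conn (n 4) (n 0)) (distC conn (n 4) (n 2)) (distC conn (n 4) D).
  have -> : dist D (n 2) = 1 by apply/(dist1 conn); case: sqD => [[]].
  rewrite !nd //=; lia.
have cE j : 2 < j -> j < M -> dist (c j) E = 1.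
  move=> j3 jM; have [dbc _] := square_dist2 (sqc j3 jM).
  have := nE (c j); have := pos (n 2) (sqc j3 jM); have := pos (n 4) (sqc j3 jM).
  rewrite (distC conn (c j) b) dbc !n_b; [|lia..].
  rewrite (distC conn (n 4) (n 1)) (distC conn (n 2) (n 1)).
  rewrite (distC conn (c j) (n 2)) (distC conn (c j) (n 4)).
  have [->|->] : j = 3 \/ j = 4 by lia.
    by rewrite (distC conn (n 4) (n 3)) !nd //=; lia.
  by rewrite (distvv conn) !nd //=; lia.
have [_ gf] := diag n1E.
have cD : common (n 1) E D by split; [exact: pivot_hub_adj|apply/(dist1 conn)].
have cc j : 2 < j -> j < M -> common (n 1) E (c j).
  by move=> j3 jM; split; [exact: pivot_adj|apply/(dist1 conn)/cE].
have a3 : adj D (c 3) by apply/(dist1 conn); rewrite pivot_dist_hub.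
have a4 : adj D (c 4) by apply/(dist1 conn); rewrite pivot_dist_hub // M5E.
have a34 : adj (c 3) (c 4) by apply/(dist1 conn); rewrite pivot_dist.
have [] := gf D (c 3) (c 4) cD (cc 3 _ _) (cc 4 _ _)
  (adj_neq a3) (adj_neq a34) (adj_neq a4) => //.
by case.
Qed.

End Pivot.

Lemma shorter_odd_walk : M = 5 \/ 7 <= M ->
  exists K : end_graph (n 1), walk (M - 2) K K.
Proof.
move=> M57.
have [D sqD] : exists D, is_square b (n 0) D (n 2) by apply: cycle_square; lia.
have ex j : exists c, 2 < j -> j < M -> is_square b (n 1) c (n j).
  have [/andP[j2 jM]|nj] := boolP (2 < j < M); last first.
    by exists b => j2 jM; rewrite j2 jM in nj.
  have [c sq] : exists c, is_square b (n 1) c (n j) by apply: cycle_square; lia.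
  by exists c.
have [c sqc] := boolp.choice ex.
case: M57 => [/(pivot_pentagon sqD sqc)//|]; exact: (pivot_shorter_walk sqD sqc).
Qed.

End Cycle.

(** Strong induction on the length, for all links at once, since the pivot changes
    the link. *)
Lemma no_odd_walk m b (K : end_graph b) : ~ walk m.*2.+1 K K.
Proof.
have [l] := ubnP m; elim: l m b K => // l IHl m b K ml wK.
have short k (K' : end_graph b) : odd k -> k < m.*2.+1 -> ~ walk k K' K'.
  move=> ok km w; apply: (IHl k./2 b K'); first by lia.
  by rewrite (_ : k./2.*2.+1 = k) //; have := odd_double_half k; lia.
have [h [h0 hM hh]] := walk_vertices wK.
have seg i j : i <= j -> j <= m.*2.+1 -> walk (j - i) (h i) (h j).
  by move=> ij jM; apply: walk_seq ij jM hh.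
have iso k i j : i <= j -> j <= m.*2.+1 -> walk k (h i) (h j) ->
    j - i <= k \/ m.*2.+1 - (j - i) <= k.
  move=> ij jM w.
  have [?|?] := leqP (j - i) k; first by left.
  right; apply: contrapT => /negP ?.
  have [e|e] := boolP (odd (k + (j - i))).
    apply: (short _ (h i) e); first by lia.
    by apply: walk_cat w _; apply: walk_sym; apply: seg.
  apply: (short (i + k + (m.*2.+1 - j)) (h 0)); [lia|lia|].
  apply: walk_cat; last by rewrite h0 -{2}hM; apply: seg.
  by apply: walk_cat w; rewrite -{1}(subn0 i); apply: seg => //; lia.
have exn i : exists s, i < m.*2.+1 -> h i s /\ h i.+1 s.
  have [iM|iM] := boolP (i < m.*2.+1); last first.
    by have [_ _ _ [s _]] := hh 0 isT; exists s.
  by have [_ _ _ [s sP]] := hh i iM; exists s.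
have [n nP] := boolp.choice exn.
have [m0|m1|m2] := ltngtP m 1.
- have {}m0 : m = 0 by lia.
  by have := hh 0 isT; rewrite m0 in hM; rewrite h0 hM => /adj_irr.
- have n1 : adj b (n 1).
    have [h1 _] := nP 1 ltac:(lia); have [e1 _ _ _] := hh 1 ltac:(lia).
    exact: (end_link e1).
  have [K' wK'] : exists K' : end_graph (n 1), walk (m.*2.+1 - 2) K' K'.
    apply: (@shorter_odd_walk b m.*2.+1 h n) => //; try lia.
    by rewrite hM h0.
  by apply: (IHl m.-1 (n 1) K'); [lia|rewrite (_ : m.-1.*2.+1 = m.*2.+1 - 2) //; lia].
(* A closed walk of length three would put one vertex of the link in three ends. *)
rewrite m2 in hM hh nP.
have [e0 e1 n01 _] := hh 0 isT; have [_ e2 n12 _] := hh 1 isT.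
have [_ e3 n23 _] := hh 2 isT.
have [n0h0 n0h1] := nP 0 isT; have [n1h1 n1h2] := nP 1 isT.
have [n2h2 n2h3] := nP 2 isT.
have h30 : h 3 = h 0 by rewrite hM h0.
rewrite h30 in n23 n2h3.
have three s : h 0 s -> h 1 s -> h 2 s -> False.
  by move=> s0 s1 s2; have [||] := two_ends e0 e1 e2 s0 s1 s2; [|exact: nesym|].
have a01 : n 0 <> n 1 by move=> e; apply: (three (n 0)) => //; rewrite e.
have a12 : n 1 <> n 2 by move=> e; apply: (three (n 1)) => //; rewrite e.
have a02 : n 0 <> n 2 by move=> e; apply: (three (n 0)) => //; rewrite e.
apply: (three (n 2)) => //; apply: (end_closed e1 n0h1 n1h1 a01).
- exact: (end_link e0).
- exact: (end_clique e0).
- exact: (end_clique e2).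
Qed.

Lemma class_label (F : finType) (R : F -> F -> Prop) :
  (forall i, R i i) -> (forall i j, R i j -> R j i) ->
  (forall i j k, R i j -> R j k -> R i k) ->
  exists f : F -> F, forall i j, f i = f j <-> R i j.
Proof.
move=> Rr Rs Rt.
pose f i := odflt i [pick j | `[< R i j >]].
have fR i : R i (f i).
  by rewrite /f; case: pickP => [j /asboolP//|/(_ i) /asboolP].
exists f => i j; split=> [fij|ij].
  by apply: (Rt _ _ _ (fR i)); rewrite fij; exact: Rs.
rewrite /f (eq_pick (Q := fun k => `[< R j k >])).
  by case: pickP => // /(_ j) /asboolP.
by move=> k; apply: asbool_equiv_eq; split; apply: Rt; [exact: Rs|].
Qed.

(** The two labels of a neighbour of [b] are the ends of either colour that
    contain it. *)
Lemma link_labels b (F : finType) (nb : F -> G) :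
  injective nb -> (forall i, adj b (nb i)) ->
  exists x y : F -> F,
    (forall i j, x i = x j -> y i = y j -> i = j) /\
    forall i j, i <> j -> (adj (nb i) (nb j) <-> x i = x j \/ y i = y j).
Proof.
move=> nb_inj b_nb.
have [col colP] := @two_colouring (end_graph b) set0 (fun m K => @no_odd_walk m b K).
pose R e i j := i = j \/ exists K, [/\ is_end b K, col K = e, K (nb i) & K (nb j)].
have same K K' s e : is_end b K -> is_end b K' -> col K = e -> col K' = e ->
    K s -> K' s -> K = K'.
  move=> eK eK' cK cK' Ks K's; apply: contrapT => nKK'.
  have : col K = ~~ col K' by apply: colP; split=> //; exists s.
  by rewrite cK cK'; case: e {cK cK'}.
have label e : exists f : F -> F, forall i j, f i = f j <-> R e i j.
  apply: class_label.
  - by move=> i; left.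
  - by move=> i j [->|[K [? ? ? ?]]]; [left|right; exists K].
  - move=> i j k [->//|[K [eK cK Ki Kj]]] [<-|[K' [eK' cK' K'j K'k]]].
      by right; exists K.
    by right; exists K; split=> //; rewrite (same K K' (nb j) e).
have [x xR] := label true; have [y yR] := label false.
exists x, y; split=> [i j /xR [//|[K [eK cK Ki Kj]]] /yR [//|[K' [eK' cK' K'i K'j]]]|].
  apply: contrapT => nij.
  suff KK' : K = K' by move: cK'; rewrite -KK' cK.
  by apply: (end_eq eK eK' Ki Kj) => // /nb_inj.
move=> i j nij; rewrite xR yR; split.
  move=> aij; have eK := edge_endP (b_nb i) (b_nb j) aij.
  case ce: (col (edge_end b (nb i) (nb j))); [left|right]; right.
    by exists (edge_end b (nb i) (nb j)); split=> //;
      [exact: edge_end1|exact: edge_end2].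
  by exists (edge_end b (nb i) (nb j)); split=> //;
    [exact: edge_end1|exact: edge_end2].
by case=> -[//|[K [eK _ Ki Kj]]]; apply: (end_clique eK) => // /nb_inj.
Qed.

End Link.

(** * Coordinates of the vertices *)

Lemma card_sum_set (S T : finType) (W : {set S + T}) :
  #|W| = #|[set a | inl a \in W]%SET| + #|[set c | inr c \in W]%SET|.
Proof.
rewrite -sum1_card big_mkcond big_sumType /= -!big_mkcond /= !sum1dep_card.
by [].
Qed.

Section Coordinates.
Variable G : sgraph.
Hypothesis conn : graph_connected G.
Hypothesis diag : forall u v : G, dist u v = 2 -> diagonal_condition u v.
Hypothesis pos : positioning_condition G.
Variables (b : G) (F : finType) (nb : F -> G) (x y : F -> F).
Hypothesis nb_inj : injective nb.
Hypothesis nb_adj : forall i, adj b (nb i).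
Hypothesis nb_onto : forall s, adj b s -> exists i, nb i = s.
Hypothesis xy_inj : forall i j, x i = x j -> y i = y j -> i = j.
Hypothesis xy_adj : forall i j, i <> j ->
  (adj (nb i) (nb j) <-> x i = x j \/ y i = y j).
Implicit Types (A B C E P Q : G) (i j l : F).

(** The neighbours of [b] on a geodesic from [b] to [A]. *)
Definition descent A : {set F} := [set i | (dist (nb i) A).+1 == dist b A]%SET.

Definition removed A : {set F} := x @: descent A.
Definition added A : {set F} := y @: descent A.

Lemma descentP A i : reflect ((dist (nb i) A).+1 = dist b A) (i \in descent A).
Proof. by rewrite inE; exact: eqP. Qed.

Lemma nb_dist A i : dist (nb i) A <= dist b A + 1 /\ dist b A <= dist (nb i) A + 1.
Proof.
by rewrite !(distC conn _ A); split; apply: dist_adj => //; exact: adj_sym.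
Qed.

(** Suppose that [j] and [l] descend to [A] and [i] combines their labels. A square
    between [nb j] and [nb l] either contains [b], and then its opposite corner is
    two steps closer to [A] than [b] and adjacent to [nb i]; or its free corners
    are equally close as [nb j], and then [nb i] must be one of them, since
    otherwise it would form a triangle with [b] and a free corner. *)
Lemma descent_product A i j l : j \in descent A -> l \in descent A ->
  x j = x i -> y l = y i -> i \in descent A.
Proof.
move=> jA lA xji yli.
have [->//|/eqP nij] := eqVneq i j; have [->//|/eqP nil] := eqVneq i l.
have [ejl|/eqP njl] := eqVneq j l.
  by case: nij; apply: xy_inj => //; rewrite ejl.
have aij : adj (nb j) (nb i) by apply/adj_sym/xy_adj => //; left.
have ail : adj (nb i) (nb l) by apply/xy_adj => //; right.
have ajl : ~ adj (nb j) (nb l).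
  move=> /(xy_adj njl) [e|e]; first by apply: nil; apply: xy_inj; rewrite -?xji.
  by apply: nij; apply: xy_inj; rewrite ?e.
have d2 : dist (nb j) (nb l) = 2 by apply: (dist2 conn aij) => // /nb_inj.
have [[P [Q sq]] gf] := diag d2.
have cb : common (nb j) (nb l) b by split=> //; exact: adj_sym.
have ci : common (nb j) (nb l) (nb i) by split.
have nbi := adj_neq (nb_adj i).
have [[jP Pl lQ Qj] [_ [nPQ PQ]]] := sq.
have cP : common (nb j) (nb l) P by split.
have cQ : common (nb j) (nb l) Q by split; exact: adj_sym.
move/descentP: jA => dj; move/descentP: lA => dl.
have sum := pos A sq; rewrite !(distC conn A) in sum.
have [dub dlb] := nb_dist A i.
apply/descentP; apply: contrapT => nd.
have opp R S : common (nb j) (nb l) R -> R <> b -> b = S -> S <> R -> ~ adj S R ->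
    dist R A + dist S A = dist (nb j) A + dist (nb l) A -> False.
  move=> cR nRb bS nSR SR; rewrite -bS => dS.
  have niR : nb i <> R by move=> e; rewrite -e in dS; lia.
  have [_ ] := gf R b (nb i) cR cb ci nRb nbi (nesym niR).
  rewrite bS => /(_ (fun h => SR (adj_sym h))) Ri.
  by have := dist_adj conn A (adj_sym Ri); rewrite !(distC conn A); lia.
have nQP := nesym nPQ; have QP : ~ adj Q P by move=> /adj_sym.
have [ePb|nPb] := pselect (b = P).
  by apply: (opp Q P cQ _ ePb nPQ PQ); [rewrite ePb|lia].
have [eQb|nQb] := pselect (b = Q).
  by apply: (opp P Q cP _ eQb nQP QP); [rewrite eQb|lia].
have [_ /(_ PQ) bP] := gf P Q b cP cQ cb nPQ (nesym nQb) (nesym nPb).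
have [_ /(_ (fun h => PQ (adj_sym h))) bQ] :=
  gf Q P b cQ cP cb (nesym nPQ) (nesym nPb) (nesym nQb).
have hP := dist_adj conn A (adj_sym bP); have hQ := dist_adj conn A (adj_sym bQ).
rewrite !(distC conn A) in hP hQ.
have nPi : P <> nb i by move=> e; rewrite e in sum hP; lia.
have nQi : Q <> nb i by move=> e; rewrite e in sum hQ; lia.
have [_ /(_ PQ) Pi] := gf P Q (nb i) cP cQ ci nPQ nQi nPi.
by have [tri _] := gf P b (nb i) cP cb ci (nesym nPb) nbi nPi; apply: tri.
Qed.

(** Each label shared with a descending neighbour brings [nb i] one step closer to
    [A]. That a neighbour at the same distance as [b] has a shared label is the
    triangle condition for its edge to [b]. *)
Lemma nb_dist_labels A i :
  dist (nb i) A + (x i \in removed A) + (y i \in added A) = dist b A + 1.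
Proof.
have [dub dlb] := nb_dist A i.
have [iA|iA] := boolP (i \in descent A).
  rewrite !imset_f // addn1 -addnA; move/descentP: iA; lia.
have near j : j \in descent A -> x i = x j \/ y i = y j -> dist (nb i) A <= dist b A.
  move=> jA xyij; have [eij|/eqP nij] := eqVneq i j; first by rewrite eij jA in iA.
  have aij : adj (nb i) (nb j) by apply/xy_adj.
  by have := dist_adj conn A aij; rewrite !(distC conn A); move/descentP: jA; lia.
have notboth : ~~ ((x i \in removed A) && (y i \in added A)).
  apply: contra iA => /andP[/imsetP[j jA xij] /imsetP[l lA yil]].
  exact: (descent_product jA lA (esym xij) (esym yil)).
have nd : (dist (nb i) A).+1 <> dist b A by move/descentP: iA.
have [d0|d1] : dist (nb i) A = dist b A \/ dist (nb i) A = dist b A + 1 by lia.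
  suff : (x i \in removed A) || (y i \in added A).
    by move: notboth; case: (x i \in _); case: (y i \in _) => //=; lia.
  case dbA: (dist b A) d0 => [|k] d0.
    by have /adj_neq := nb_adj i; rewrite (dist0 conn dbA) (dist0 conn d0).
  have [|||t [bt tnb dt]] := @triangle_condition G conn diag pos A b (nb i) k.
  - exact: nb_adj.
  - by rewrite (distC conn).
  - by rewrite (distC conn).
  have [j jt] := nb_onto bt; rewrite -jt in tnb dt.
  have jA : j \in descent A by apply/descentP; rewrite (distC conn) dt dbA.
  have nij : i <> j by move=> e; move: tnb; rewrite e => /adj_irr.
  have [e|e] := iffLR (xy_adj nij) (adj_sym tnb).
    by rewrite e (imset_f x jA).
  by rewrite e (imset_f y jA) orbT.
have -> : x i \in removed A = false.
  by apply/negP => /imsetP[j jA xij]; have := near j jA (or_introl xij); lia.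
have -> : y i \in added A = false.
  by apply/negP => /imsetP[j jA yij]; have := near j jA (or_intror yij); lia.
lia.
Qed.

(** Positioning from [b] and from [nb i], expressed by labels. *)
Lemma square_labels A P E Q : is_square A P E Q -> forall i,
  ((x i \in removed A) + (y i \in added A)) +
    ((x i \in removed E) + (y i \in added E)) =
  ((x i \in removed P) + (y i \in added P)) +
    ((x i \in removed Q) + (y i \in added Q)).
Proof.
move=> sq i; have := pos b sq; have := pos (nb i) sq.
have := nb_dist_labels A i; have := nb_dist_labels P i.
have := nb_dist_labels E i; have := nb_dist_labels Q i; clear; lia.
Qed.

Lemma descent_below C A : dist b C + dist C A = dist b A ->
  descent C \subset descent A.
Proof.
move=> CA; apply/fintype.subsetP => i /descentP iC; apply/descentP.
by have := dist_triangle conn C (nb i) A; have [] := nb_dist A i; lia.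
Qed.

Lemma labels_below C A : dist b C + dist C A = dist b A ->
  removed C \subset removed A /\ added C \subset added A.
Proof. by move=> /descent_below CA; split; exact: imsetS. Qed.

Lemma base_descent A : dist b A = 0 -> descent A = finset.set0.
Proof. by move=> A0; apply/finset.setP => i; rewrite !inE A0. Qed.

Lemma link_descent i : descent (nb i) = [set i]%SET.
Proof.
apply/finset.setP => j; rewrite !inE (iffRL (dist1 conn _ _) (nb_adj i)) eqSS.
apply/eqP/eqP => [/(dist0 conn) /nb_inj //|->]; exact: distvv.
Qed.

(** [z] and [w] are [x] and [y] in either order. *)
Lemma square_meet (z w : F -> F) A P E Q :
  w @: descent E \subset w @: descent Q ->
  (forall i, ((z i \in z @: descent A) + (w i \in w @: descent A)) +
    ((z i \in z @: descent E) + (w i \in w @: descent E)) =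
  ((z i \in z @: descent P) + (w i \in w @: descent P)) +
    ((z i \in z @: descent Q) + (w i \in w @: descent Q))) ->
  forall a, a \in z @: descent P -> a \in z @: descent Q -> a \in z @: descent E.
Proof.
move=> /fintype.subsetP wEQ sum _ /imsetP[i iP ->] ziQ.
have := sum i; have := wEQ (w i); rewrite ziQ (imset_f z iP) (imset_f w iP).
case: (w i \in w @: descent E) => [/(_ isT) ->|_]; case: (z i \in z @: descent E) => //.
  by case: (z i \in _); case: (w i \in _).
by case: (z i \in _); case: (w i \in _); case: (w i \in _).
Qed.

Lemma square_join (z w : F -> F) A P E Q :
  (forall i, ((z i \in z @: descent A) + (w i \in w @: descent A)) +
    ((z i \in z @: descent E) + (w i \in w @: descent E)) =
  ((z i \in z @: descent P) + (w i \in w @: descent P)) +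
    ((z i \in z @: descent Q) + (w i \in w @: descent Q))) ->
  (forall a, a \in w @: descent P -> a \in w @: descent Q -> a \in w @: descent E) ->
  z @: descent A \subset z @: descent P :|: z @: descent Q.
Proof.
move=> sum meet; apply/fintype.subsetP => _ /imsetP[i iA ->].
have := sum i; have := meet (w i); rewrite inE (imset_f z iA) (imset_f w iA).
case: (z i \in z @: descent P) => //=; case: (z i \in z @: descent Q) => //=.
case: (w i \in w @: descent P); case: (w i \in w @: descent Q) => //=.
  by move=> /(_ isT isT) ->; case: (z i \in _).
all: by move=> _; case: (z i \in _); case: (w i \in _).
Qed.

(** In a square [A], [P], [E], [Q] descending towards [b], the label sets of [A] and
    [E] are the joins and meets of those of [P] and [Q]. *)
Lemma card_labels A : #|removed A| = dist b A /\ #|added A| = dist b A.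
Proof.
have [n] := ubnP (dist b A); elim: n A => // n IHn A.
case dA: (dist b A) => [|[|k]] ltn.
- by rewrite /removed /added base_descent // !imset0 cards0.
- have [i <-] : exists i, nb i = A by apply/nb_onto/(dist1 conn).
  by rewrite /removed /added link_descent !imset_set1 !cards1.
have [A' A'A dA'] := closer conn dA; have [E EA' dE] := closer conn dA'.
have dAE : dist A E = 2.
  apply: (dist2 conn (adj_sym A'A) (adj_sym EA')).
    by move=> e; move: dA; rewrite e dE; lia.
  by move=> AE; have := dist_adj conn b AE; lia.
have [P [Q sq]] := dist2_square diag dAE.
have level R : adj A R -> adj R E -> dist b R = k.+1.
  by move=> AR RE; have := dist_adj conn b AR; have := dist_adj conn b RE; lia.
have [[AP PE EQ QA] _] := sq.
have dP := level P AP PE; have dQ := level Q (adj_sym QA) (adj_sym EQ).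
have [cPx cPy] := IHn P ltac:(lia); have [cQx cQy] := IHn Q ltac:(lia).
have [cEx cEy] := IHn E ltac:(lia).
have below C D : adj C D -> dist b D = (dist b C).+1 ->
    removed C \subset removed D /\ added C \subset added D.
  move=> CD dD; apply: labels_below; rewrite (iffRL (dist1 conn _ _) CD); lia.
have [EPx EPy] := below E P (adj_sym PE) ltac:(lia).
have [EQx EQy] := below E Q EQ ltac:(lia).
have [PAx PAy] := below P A (adj_sym AP) ltac:(lia).
have [QAx QAy] := below Q A QA ltac:(lia).
have sum := square_labels sq.
have sum' i := etrans (congr2 addn (addnC _ _) (addnC _ _))
  (etrans (sum i) (congr2 addn (addnC _ _) (addnC _ _))).
have meetx := square_meet EQy sum.
have meety := square_meet EQx sum'.
have joinx := square_join sum meety.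
have joiny := square_join sum' meetx.
have incl_excl (U V W Z : {set F}) : U \subset W -> V \subset W -> W \subset U :|: V ->
    Z \subset U -> Z \subset V -> (forall a, a \in U -> a \in V -> a \in Z) ->
    #|W| + #|Z| = #|U| + #|V|.
  move=> UW VW WUV ZU ZV meet; rewrite -[RHS]cardsUI.
  have -> : W = U :|: V.
    by apply/eqP; rewrite finset.eqEsubset WUV finset.subUset UW.
  have -> // : Z = U :&: V.
  apply/eqP; rewrite finset.eqEsubset finset.subsetI ZU ZV /=.
  by apply/fintype.subsetP => a; rewrite inE => /andP[aU aV]; exact: meet.
have cx : #|removed A| + #|removed E| = #|removed P| + #|removed Q|.
  exact: incl_excl.
have cy : #|added A| + #|added E| = #|added P| + #|added Q| by exact: incl_excl.
rewrite cPx cQx cEx dP dQ dE in cx; rewrite cPy cQy cEy dP dQ dE in cy.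
by clear -cx cy; lia.
Qed.

(** The set [lam A] stands for the basis [A]: the left summand of the ground set
    carries the elements of [b], the right summand those outside [b]. *)
Definition lam A : {set F + F} :=
  [set z | match z with
           | inl a => (a \in x @: [set: F]) && (a \notin removed A)
           | inr c => c \in added A
           end]%SET.

Lemma removed_sub A : removed A \subset x @: [set: F].
Proof. by apply: imsetS; exact: finset.subsetT. Qed.

Lemma lam_removed A i : (inl (x i) \in lam A) = (x i \notin removed A).
Proof. by rewrite inE imset_f ?inE. Qed.

Lemma lam_added A i : (inr (y i) \in lam A) = (y i \in added A).
Proof. by rewrite inE. Qed.

Lemma card_lam A : #|lam A| = #|x @: [set: F]|.
Proof.
have [cx cy] := card_labels A.
rewrite card_sum_set -(cardsID (removed A) (x @: [set: F])).
rewrite (finset.setIidPr (removed_sub A)) addnC cx -cy; congr (_ + _).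
  by apply: eq_card => c; rewrite !inE.
by apply: eq_card => a; rewrite !inE andbC.
Qed.

Lemma card_lamD A B :
  #|lam A :\: lam B| = #|removed B :\: removed A| + #|added A :\: added B|.
Proof.
rewrite card_sum_set; congr (_ + _); apply: eq_card => a; rewrite !inE //.
have := fintype.subsetP (removed_sub B) a.
by case: (a \in removed B) => [/(_ isT) ->|_]; rewrite ?andbT ?andbF //=;
  case: (a \in x @: _); case: (a \in removed A).
Qed.

(** On a geodesic from [b] the label sets grow, so that their sizes determine the
    difference. *)
Lemma lam_below C A : dist b C + dist C A = dist b A ->
  #|lam A :\: lam C| = dist C A /\ #|lam C :\: lam A| = dist C A.
Proof.
move=> CA; have [rCA aCA] := labels_below CA.
have AC : #|lam A :\: lam C| = dist C A.
  rewrite card_lamD (eqP (_ : removed C :\: removed A == finset.set0)); last first.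
    by rewrite finset.setD_eq0.
  rewrite cards0 cardsDS // (card_labels A).2 (card_labels C).2; lia.
by split=> //; rewrite -AC; apply: card_setD_sym; rewrite !card_lam.
Qed.

(** * The coordinates form an isometric embedding *)

(** The positive part of the multiset difference of [lam A], [lam B] and [lam P],
    [lam Q]. *)
Definition excess A B P Q (z : F + F) :=
  (z \in lam P) + (z \in lam Q) < (z \in lam A) + (z \in lam B).

(** [square_labels] in terms of [lam]: the multiset difference takes the same value
    at the two labels of a neighbour of [b]. *)
Lemma square_coupled A P B Q i : is_square A P B Q ->
  (inr (y i) \in lam A) + (inr (y i) \in lam B) +
    ((inl (x i) \in lam P) + (inl (x i) \in lam Q)) =
  (inr (y i) \in lam P) + (inr (y i) \in lam Q) +
    ((inl (x i) \in lam A) + (inl (x i) \in lam B)).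
Proof.
move=> sq; have := square_labels sq i; rewrite !lam_removed !lam_added.
by do 4 (case: (x i \in _)); case: (y i \in _); case: (y i \in _);
  case: (y i \in _); case: (y i \in _).
Qed.

Lemma excess_coupled A P B Q i : is_square A P B Q ->
  excess A B P Q (inr (y i)) = excess A B P Q (inl (x i)).
Proof.
move=> sq; rewrite /excess -(ltn_add2r ((inl (x i) \in lam P) + (inl (x i) \in lam Q))).
by rewrite (square_coupled i sq) ltn_add2l.
Qed.

Lemma excess_le2 A P B Q z1 z2 z3 :
  #|lam A :\: lam P| = 1 -> #|lam B :\: lam Q| = 1 ->
  excess A B P Q z1 -> excess A B P Q z2 -> excess A B P Q z3 ->
  z1 != z2 -> z1 != z3 -> z2 != z3 -> False.
Proof.
move=> AP BQ e1 e2 e3 n12 n13 n23.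
have sub z : excess A B P Q z -> z \in (lam A :\: lam P) :|: (lam B :\: lam Q).
  rewrite /excess finset.in_setU !finset.in_setD.
  by case: (z \in lam A); case: (z \in lam B); case: (z \in lam P); case: (z \in lam Q).
have : [set z3; z1; z2]%SET \subset (lam A :\: lam P) :|: (lam B :\: lam Q).
  apply/fintype.subsetP => z zin; apply: sub; move: zin.
  by rewrite !inE -orbA => /or3P[] /eqP ->.
move=> /subset_leq_card /leq_trans /(_ (leq_card_setU _ _)).
rewrite AP BQ -finset.setUA cardsU1 cards2 n12 !inE negb_or.
by rewrite ![z3 == _]eq_sym n13 n23.
Qed.

(** Excess at an added element of [A] forces excess at two further elements: the
    equation of [square_coupled] passes it between the two labels of a neighbour
    of [b], first for a neighbour on a geodesic to [A], then for one on a
    geodesic to [B] or to [P]. *)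
Lemma square_excess_added A P B Q c : is_square A P B Q ->
  #|lam A :\: lam P| = 1 -> #|lam B :\: lam Q| = 1 ->
  inr c \in lam A -> ~ excess A B P Q (inr c).
Proof.
move=> sq AP BQ cA exc.
have couple i := excess_coupled i sq.
have /imsetP[i iA ci] : c \in added A by move: cA; rewrite inE.
rewrite {}ci in cA exc.
have xA : inl (x i) \notin lam A by rewrite lam_removed negbK imset_f.
have exi : excess A B P Q (inl (x i)) by rewrite -couple.
have [xB xP xQ] :
    [/\ inl (x i) \in lam B, inl (x i) \notin lam P & inl (x i) \notin lam Q].
  move: exi; rewrite /excess (negbTE xA).
  by case: (_ \in lam B); case: (_ \in lam P); case: (_ \in lam Q).
have cE := square_coupled i sq.
rewrite cA xB (negbTE xA) (negbTE xP) (negbTE xQ) in cE.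
have [cB|cB] := boolP (inr (y i) \in lam B).
  have /imsetP[j jB cj] : y i \in added B by move: cB; rewrite inE.
  have xjB : inl (x j) \notin lam B by rewrite lam_removed negbK imset_f.
  have exj : excess A B P Q (inl (x j)) by rewrite -couple -cj.
  apply: (excess_le2 AP BQ exc exi exj) => //.
  by apply: contraNneq xjB => <-.
have cP : inr (y i) \notin lam P.
  by move: cE; rewrite (negbTE cB); case: (_ \in lam P); case: (_ \in lam Q).
have /imsetP[t tP xit] : x i \in removed P by move: xP; rewrite lam_removed negbK.
have yP : inr (y t) \in lam P by rewrite lam_added imset_f.
have ext : excess A B P Q (inr (y t)) by rewrite couple -xit.
apply: (excess_le2 AP BQ exc exi ext) => //.
by apply: contraNneq cP => ->.
Qed.

(** An excess at a removed element passes, along a neighbour of [b] on a geodesic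
    to [P] or [Q], to an added element. *)
Lemma square_no_excess A P B Q : is_square A P B Q ->
  #|lam A :\: lam P| = 1 -> #|lam B :\: lam Q| = 1 ->
  forall z, (z \in lam A) + (z \in lam B) <= (z \in lam P) + (z \in lam Q).
Proof.
move=> sq AP BQ z; rewrite leqNgt; apply/negP; rewrite -/(excess A B P Q z).
have no_added c : ~ excess A B P Q (inr c).
  move=> exc; have [cA|cA] := boolP (inr c \in lam A).
    exact: (square_excess_added sq AP BQ cA).
  have cB : inr c \in lam B.
    by move: exc; rewrite /excess (negbTE cA); case: (_ \in lam B); case: (_ + _).
  apply: (square_excess_added (square_rot (square_rot sq)) BQ AP cB).
  by rewrite /excess addnC [X in _ < X]addnC.
case: z => [a|c] exz; last exact: no_added exz.
have aim : a \in x @: [set: F].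
  by move: exz; rewrite /excess !inE; case: (a \in x @: _); rewrite //= ltn0.
have [R aR] : exists R, a \in removed R.
  move: exz; rewrite /excess !inE aim /=.
  case aP: (a \in removed P); first by exists P.
  case aQ: (a \in removed Q); first by exists Q.
  by case: (_ \notin _); case: (_ \notin _).
have /imsetP[t _ at_] := aR; apply: (no_added (y t)).
by rewrite (excess_coupled t sq) -at_.
Qed.

Lemma square_lam_balanced A P B Q : is_square A P B Q ->
  #|lam A :\: lam P| = 1 -> #|lam P :\: lam B| = 1 ->
  #|lam B :\: lam Q| = 1 -> #|lam Q :\: lam A| = 1 ->
  balanced (lam A) (lam B) (lam P) (lam Q).
Proof.
move=> sq AP PB BQ QA z; apply/eqP; rewrite eqn_leq square_no_excess //=.
by rewrite addnC [leqRHS]addnC addnC; apply: (square_no_excess (square_rot sq)).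
Qed.

Lemma level_lamD A B : adj A B -> dist b A <> dist b B -> #|lam A :\: lam B| = 1.
Proof.
move=> AB nAB; have dAB : dist A B = 1 by apply/(dist1 conn).
have dBA : dist B A = 1 by rewrite (distC conn).
have := dist_adj conn b AB; have := dist_adj conn b (adj_sym AB) => h1 h2.
have [ltAB|leBA] := ltnP (dist b A) (dist b B).
  have [|_ ->] := @lam_below A B; lia.
by have [|-> _] := @lam_below B A; lia.
Qed.

Lemma square_lamD A P B Q : is_square A P B Q ->
  (forall u v, adj u v -> (u = A \/ u = B) -> (v = P \/ v = Q) ->
    #|lam u :\: lam v| = 1) ->
  balanced (lam A) (lam B) (lam P) (lam Q).
Proof.
move=> sq edge; have [[AP PB BQ QA] _] := sq.
have sym u v : #|lam u :\: lam v| = 1 -> #|lam v :\: lam u| = 1.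
  by move=> <-; apply: card_setD_sym; rewrite !card_lam.
apply: square_lam_balanced => //.
- by apply: edge => //; left.
- by apply/sym/edge; [exact: adj_sym|right|left].
- by apply: edge => //; right.
- by apply/sym/edge; [exact: adj_sym|left|right].
Qed.

(** The square with diagonal [A], [B] is balanced, so that the distances from
    [lam A] to its corners add up. *)
Lemma same_level_two_apart A B :
  (forall u v, adj u v -> dist b u = dist b A -> dist b v = dist b A ->
    #|lam u :\: lam v| = 1) ->
  dist A B = 2 -> dist b A = dist b B -> #|lam A :\: lam B| = 2.
Proof.
move=> edge dAB eAB; have [P [Q sq]] := dist2_square diag dAB.
have bal : balanced (lam A) (lam B) (lam P) (lam Q).
  apply: square_lamD => // u v uv hu hv.
  have eu : dist b u = dist b A by case: hu => ->.
  have [ev|nv] := eqVneq (dist b v) (dist b A); first exact: edge.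
  by apply: level_lamD => //; rewrite eu; apply/eqP; rewrite eq_sym.
have [[AP PB BQ QA] _] := sq.
have one v : adj A v -> #|lam A :\: lam v| = 1.
  move=> Av; have [ev|/eqP nv] := eqVneq (dist b v) (dist b A); first exact: edge.
  by apply: level_lamD => //; exact: nesym.
have := balanced_card_setD (lam A) bal; rewrite finset.setDv cards0.
by rewrite (one P AP) (one Q (adj_sym QA)).
Qed.

(** Both vertices see a common vertex [C] two levels below. The Johnson distances
    from one of them to the corners of a square between [C] and the other are
    known, except the one that is sought. *)
Lemma same_level_lamD A B : adj A B -> dist b A = dist b B ->
  #|lam A :\: lam B| = 1.
Proof.
have [n] := ubnP (dist b A); elim: n A B => // n IHn A B.
case dA: (dist b A) => [|[|k]] ltn AB dB.
- by move: AB; rewrite -(dist0 conn dA) -(dist0 conn (esym dB)) => /adj_irr.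
- have [i ei] : exists i, nb i = A by apply/nb_onto/(dist1 conn).
  have [j ej] : exists j, nb j = B by apply/nb_onto/(dist1 conn).
  have nij : i <> j by move=> e; move: AB; rewrite -ei -ej e => /adj_irr.
  have := iffLR (xy_adj nij); rewrite ei ej => /(_ AB) xyij.
  have := @xy_inj i j.
  rewrite card_lamD /removed /added -ei -ej !link_descent !imset_set1.
  rewrite !finset.setDE; case: xyij => e.
    rewrite e finset.setICr cards0 add0n => yij.
    rewrite (finset.setIidPl _) ?cards1 // finset.sub1set !inE.
    by apply/eqP => eyij; apply: nij; exact: yij.
  rewrite e finset.setICr cards0 addn0 => xij.
  rewrite (finset.setIidPl _) ?cards1 // finset.sub1set !inE eq_sym.
  by apply/eqP => exij; apply: nij; apply: xij.
have [E [AE EB dE]] := triangle_condition conn diag pos AB dA (esym dB).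
have [C CE dC] := closer conn dE.
have two_below D : adj D E -> dist b D = k.+2 -> dist D C = 2.
  move=> DE dD; apply: (dist2 conn DE (adj_sym CE)).
    by move=> e; move: dD; rewrite e dC; lia.
  by move=> DC; have := dist_adj conn b DC; rewrite dD dC; lia.
have dAC := two_below A AE dA; have dBC := two_below B (adj_sym EB) (esym dB).
have level D R : dist b D = k.+2 -> adj C R -> adj R D -> dist b R = k.+1.
  move=> dD CR RD; have := dist_adj conn b (adj_sym CR).
  by have := dist_adj conn b (adj_sym RD); lia.
have cross := level_lamD.
have bal D P Q : dist b D = k.+2 -> is_square C P D Q ->
    balanced (lam C) (lam D) (lam P) (lam Q).
  move=> dD sq; apply: square_lamD => // u v uv hu hv; apply: cross => //.
  have [[CP PD DQ QC] _] := sq.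
  have dP := level D P dD CP PD; have dQ := level D Q dD (adj_sym QC) (adj_sym DQ).
  by case: hu => ->; case: hv => ->; rewrite ?dC ?dD ?dP ?dQ; lia.
have dBE : dist b B = k.+2 by [].
have [P [Q sq]] : exists P Q, is_square C P A Q.
  by apply: (dist2_square diag); rewrite (distC conn).
have dBA : dist B A = 1 by apply/(dist1 conn)/adj_sym.
have neq0 R : adj C R -> dist B R <> 0.
  move=> CR /(dist0 conn) e; move: dBC.
  by rewrite e (distC conn) (iffRL (dist1 conn _ _) CR).
wlog [dBP dBQ] : P Q sq / dist B P = 1 /\ dist B Q = 2.
  move=> wl; have := pos B sq; rewrite dBC dBA => sum.
  have [[CP _ _ QC] _] := sq; have := neq0 P CP; have := neq0 Q (adj_sym QC).
  have [?|?] : dist B P = 1 \/ dist B P <> 1 by lia.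
    by move=> *; apply: (wl P Q) => //; lia.
  by move=> *; apply: (wl Q P); [exact: square_flip|lia].
have [[CP PA AQ QC] _] := sq.
have dP := level A P dA CP PA; have dQ := level A Q dA (adj_sym QC) (adj_sym AQ).
have BC : #|lam B :\: lam C| = 2.
  by have [|-> _] := @lam_below C B; rewrite (distC conn C B) dBC // dBE dC; lia.
have BP : #|lam B :\: lam P| = 1.
  by apply: cross; [apply/(dist1 conn)|rewrite dBE dP; lia].
suff BQ : #|lam B :\: lam Q| = 2.
  rewrite card_setD_sym; last by rewrite !card_lam.
  by have := balanced_card_setD (lam B) (bal A P Q dA sq); rewrite BC BP BQ; lia.
have [R [S sq']] : exists R S, is_square C R B S.
  by apply: (dist2_square diag); rewrite (distC conn).
have IH u v : adj u v -> dist b u = k.+1 -> dist b v = k.+1 ->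
    #|lam u :\: lam v| = 1.
  by move=> uv du dv; apply: IHn; rewrite ?du ?dv.
have nQB D : adj D B -> dist Q D <> 0.
  move=> DB /(dist0 conn) e; move: dBQ.
  by rewrite e (distC conn) (iffRL (dist1 conn _ _) DB).
wlog [dQR dQS] : R S sq' / dist Q R = 1 /\ dist Q S = 2.
  move=> wl; have := pos Q sq'.
  rewrite (distC conn Q B) dBQ (iffRL (dist1 conn _ _) QC).
  have [[_ RB BS _] _] := sq'; have := nQB R RB; have := nQB S (adj_sym BS).
  have [?|?] : dist Q R = 1 \/ dist Q R <> 1 by lia.
    by move=> *; apply: (wl R S) => //; lia.
  by move=> *; apply: (wl S R); [exact: square_flip|lia].
have [[CR RB BS SC] _] := sq'.
have dR := level B R dBE CR RB; have dS := level B S dBE (adj_sym SC) (adj_sym BS).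
have QR : #|lam Q :\: lam R| = 1 by apply: IH => //; apply/(dist1 conn).
have QS : #|lam Q :\: lam S| = 2.
  by apply: same_level_two_apart; rewrite ?dQ ?dS.
have QC1 : #|lam Q :\: lam C| = 1 by apply: cross; rewrite // dQ dC; lia.
rewrite card_setD_sym; last by rewrite !card_lam.
have := balanced_card_setD (lam Q) (bal B R S dBE sq'); rewrite QR QS QC1; lia.
Qed.

Lemma adj_lamD A B : adj A B -> #|lam A :\: lam B| = 1.
Proof.
move=> AB; have [e|/eqP ne] := eqVneq (dist b A) (dist b B).
  exact: same_level_lamD.
exact: level_lamD.
Qed.

Lemma two_apart_lamD A B : dist A B = 2 -> #|lam A :\: lam B| = 2.
Proof.
move=> dAB; have [P [Q sq]] := dist2_square diag dAB.
have bal : balanced (lam A) (lam B) (lam P) (lam Q).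
  by apply: square_lamD => // u v uv _ _; exact: adj_lamD.
have [[AP PB BQ QA] _] := sq.
have := balanced_card_setD (lam A) bal; rewrite finset.setDv cards0.
by rewrite (adj_lamD AP) (adj_lamD (adj_sym QA)).
Qed.

(** Distances at most two being preserved, a square on a geodesic is balanced, and
    the first of its corners inherits its distance from the other three. *)
Lemma lam_dist A B : dist A B = #|lam A :\: lam B|.
Proof.
rewrite distC // card_setD_sym ?card_lam //.
have [n] := ubnP (dist B A); elim: n A => // n IHn A.
case dA: (dist B A) => [|[|[|k]]] ltn.
- by rewrite (dist0 conn dA) finset.setDv cards0.
- by rewrite adj_lamD //; apply/(dist1 conn).
- by rewrite two_apart_lamD.
have [C CA dC] := closer conn dA; have [E EC dE] := closer conn dC.
have dAE : dist A E = 2.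
  apply: (dist2 conn (adj_sym CA) (adj_sym EC)).
    by move=> e; move: dA; rewrite e dE; lia.
  by move=> AE; have := dist_adj conn B AE; lia.
have [P [Q sq]] := dist2_square diag dAE.
have level R : adj A R -> adj R E -> dist B R = k.+2.
  by move=> AR RE; have := dist_adj conn B AR; have := dist_adj conn B RE; lia.
have [[AP PE EQ QA] _] := sq.
have dP := level P AP PE; have dQ := level Q (adj_sym QA) (adj_sym EQ).
have bal : balanced (lam A) (lam E) (lam P) (lam Q).
  by apply: square_lamD => // u v uv _ _; exact: adj_lamD.
have := balanced_card_setD (lam B) bal.
rewrite -(IHn E) ?dE; last lia.
rewrite -(IHn P) ?dP; last lia.
rewrite -(IHn Q) ?dQ; last lia.
lia.
Qed.

End Coordinates.

(** * Isometric embeddings give matroids *)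

Section EmbeddedExchange.
Variables (G : sgraph) (I : finType) (lam : G -> {set I}).
Hypothesis conn : graph_connected G.
Hypothesis squares : forall u v : G, dist u v = 2 -> exists p q, is_square u p v q.
Hypothesis lam_card : forall u v, #|lam u| = #|lam v|.
Hypothesis lam_dist : forall u v, dist u v = #|lam u :\: lam v|.

Lemma embedded_balanced u p v q : is_square u p v q ->
  balanced (lam u) (lam v) (lam p) (lam q).
Proof.
move=> sq; have [duv dpq] := square_dist2 conn sq; have [[up pv vq qu] _] := sq.
by apply: square_balanced; rewrite -?lam_dist //; exact/(dist1 conn).
Qed.

(** Let [w] be the next vertex on a geodesic to [v]. If its step does not remove
    [a], exchange [a] from [w] by induction to reach [z]. One of the two free
    corners of a square between [u] and [z] lacks [a]. *)
Lemma embedded_exchange u v a : a \in lam u :\: lam v ->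
  exists w, exists2 c, c \in lam v :\: lam u &
    lam w = (lam u :\ a) :|: [set c]%SET.
Proof.
have [n] := ubnP (dist v u); elim: n u => // n IHn u ltn auv.
have [au av] : a \in lam u /\ a \notin lam v by move: auv; rewrite inE => /andP[].
have step w : adj u w -> a \notin lam w -> lam w \subset lam u :|: lam v ->
    exists w, exists2 c, c \in lam v :\: lam u &
      lam w = (lam u :\ a) :|: [set c]%SET.
  move=> uw aw /fintype.subsetP wuv.
  have [|||c cwu wE] := @exchangeP _ (lam u) (lam w) a.
  - exact: lam_card.
  - by rewrite -lam_dist; apply/(dist1 conn).
  - by rewrite inE aw.
  exists w, c => //; move: cwu; rewrite !inE => /andP[cu cw].
  by have := wuv c cw; rewrite inE (negbTE cu).
case duv: (dist v u) => [|k].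
  by move: av; rewrite (dist0 conn duv) au.
have [w wu dw] := closer conn duv.
have duw : dist u w = 1 by apply/(dist1 conn)/adj_sym.
have [_ wuv] : lam u :&: lam v \subset lam w /\ lam w \subset lam u :|: lam v.
  apply: card_setD_between; rewrite -!lam_dist duw.
  by rewrite (distC conn w v) (distC conn u v) dw duv.
have [aw|aw] := boolP (a \in lam w); last exact: step (adj_sym wu) aw wuv.
have [||z [c cvw zE]] := IHn w; [lia|by rewrite inE av aw|].
have az : a \notin lam z.
  rewrite zE !inE eqxx /=; apply: contraNneq av => ->.
  by move: cvw; rewrite inE => /andP[].
have zuv : lam z \subset lam u :|: lam v.
  rewrite zE; apply/fintype.subsetP => i; rewrite !finset.in_setU => /orP[|].
    by rewrite inE => /andP[_ /(fintype.subsetP wuv)]; rewrite inE.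
  by rewrite inE => /eqP ->; move: cvw; rewrite inE => /andP[_ ->]; rewrite orbT.
have dwz : dist w z <= 1.
  rewrite lam_dist -(cards1 a); apply/subset_leq_card/fintype.subsetP => i.
  by rewrite zE !inE; case: (i == a) => //=; case: (i \in lam w) => //=; rewrite andbF.
have := dist_triangle conn w u z; rewrite duw.
case duz: (dist u z) => [|[|[|m]]] dz3.
- by move: az; rewrite -(dist0 conn duz) au.
- by apply: (step z) => //; apply/(dist1 conn).
- have [p [q sq]] := squares duz; have bal := embedded_balanced sq.
  wlog ap : p q sq bal / a \notin lam p.
      move=> wl; have [ap|ap] := boolP (a \in lam p); last exact: (wl p q).
    have aq : a \notin lam q.
      by have := bal a; rewrite au (negbTE az) ap; case: (a \in lam q).
    have bal' : balanced (lam u) (lam z) (lam q) (lam p).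
      by move=> i; rewrite bal addnC.
    exact: (wl q p (square_flip sq) bal' aq).
  have [[up _ _ _] _] := sq; apply: (step p) => //.
  apply/fintype.subsetP => i ip; rewrite inE.
  have [//|iu] := boolP (i \in lam u); have := bal i; rewrite ip (negbTE iu).
  case iz: (i \in lam z) => // _; have := fintype.subsetP zuv i iz.
  by rewrite inE (negbTE iu).
- lia.
Qed.

Definition embedded_bases : {set {set I}} :=
  [set S | `[< exists u, lam u = S >]]%SET.

Lemma embedded_basesP S : S \in embedded_bases <-> exists u, lam u = S.
Proof. by rewrite inE; split=> [/asboolP|?]; [|apply/asboolP]. Qed.

Lemma embedded_bases_nonempty (u : G) : exists A, A \in embedded_bases.
Proof. by exists (lam u); apply/embedded_basesP; exists u. Qed.

Lemma embedded_bases_exchange A B : A \in embedded_bases -> B \in embedded_bases ->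
  forall a, a \in A :\: B ->
  exists2 b, b \in B :\: A & (A :\ a) :|: [set b]%SET \in embedded_bases.
Proof.
move=> /embedded_basesP[u <-] /embedded_basesP[v <-] a.
move=> /embedded_exchange[w [c cvu wE]]; exists c => //.
by apply/embedded_basesP; exists w.
Qed.

Lemma embedded_matroid (u : G) :
  exists M : matroid I, isomorphic G (basis_graph M).
Proof.
pose M := Matroid (embedded_bases_nonempty u) embedded_bases_exchange.
have mem v : lam v \in bases M by apply/embedded_basesP; exists v.
pose f v : basis_graph M := exist _ (lam v) (mem v).
have lam_inj v w : lam v = lam w -> v = w.
  by move=> e; apply: (dist0 conn); rewrite lam_dist e finset.setDv cards0.
have ex (S : basis_graph M) : exists v, f v = S.
  by case: S => S SM; have [v vS] := iffLR (embedded_basesP S) SM;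
    exists v; apply: val_inj.
have [g gK] := boolp.choice ex.
exists M, f.
  by exists g => // v; apply: lam_inj; have := gK (f v) => /(congr1 val).
move=> v w; rewrite -(dist1 conn) lam_dist /= /basis_adj /=.
by rewrite card_symdiff //; split=> [->//|e]; exact: double_inj.
Qed.

End EmbeddedExchange.

Lemma finite_enumeration (T : Type) (A : set T) : finite_set A ->
  exists n (nb : 'I_n -> T),
    [/\ injective nb, forall i, A (nb i) & forall s, A s -> exists i, nb i = s].
Proof.
move=> /finite_setP[n /card_bijP[f [g fK gK]]].
have mem (i : 'I_n) : (i : nat) \in `I_n%classic by apply/mem_set => /=.
exists n, (fun i : 'I_n => val (g (exist _ (i : nat) (mem i)))); split.
- by move=> i j /val_inj /(can_inj gK) [] /val_inj.
- by move=> i; exact: set_mem (valP _).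
move=> s As; pose z := f (exist _ s (mem_set As)).
have zn : val z < n by have := set_mem (valP z).
exists (Ordinal zn); rewrite (_ : exist _ _ _ = z) ?fK //.
exact: val_inj.
Qed.

Theorem theorem1 (G : sgraph) :
  (exists (I : finType) (M : matroid I), isomorphic G (basis_graph M)) <->
  (graph_connected G /\ interval_condition G /\ positioning_condition G /\
   exists v : G, finite_set (neighbors v)).
Proof.
split=> [[I [M iso]]|]; first exact: basis_graph_conditions iso.
move=> [conn [IC [pos [b fin]]]].
have diag := interval_diagonal conn IC.
have [n [nb [nb_inj nb_adj nb_onto]]] := finite_enumeration fin.
have [x [y [xy_inj xy_adj]]] := link_labels conn diag pos nb_inj nb_adj.
have card := card_lam conn diag pos nb_inj nb_adj nb_onto xy_inj xy_adj.
have dst := lam_dist conn diag pos nb_inj nb_adj nb_onto xy_inj xy_adj.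
have [|M iso] := embedded_matroid conn (dist2_square diag) _ dst b.
  by move=> u v; rewrite !card.
by exists ('I_n + 'I_n)%type, M.
Qed.
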